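(* Let $m\ge 1$. (i) The two-graph associated with the graph $NO^{\pm}(2m,2)$ is isomorphic to the two-graph $\mathcal{X}^{\pm}_{2m}$. (ii) The two-graph associated with the graph $NO^{\mp}(2m+1,4)$ is isomorphic to the two-graph $\mathcal{X}^{\pm}_{4m}$. (iii) The strongly regular graphs $NO^{\pm}(4m,2)$ and $NO^{\mp}(2m+1,4)$ are switching equivalent. (The signs are read consistently: upper signs together, lower signs together.)
   Context: A quadratic form $\Theta$ on $\mathbb{F}_q^{n}$ ($q$ a power of $2$) has polar form $f(u,v)=\Theta(u+v)+\Theta(u)+\Theta(v)$, which is alternating. For $n=2m$, $\Theta$ is non-degenerate if $f$ is non-degenerate; it is then of type $+1$ (hyperbolic) if its Witt index is $m$ and of type $-1$ (elliptic) if its Witt index is $m-1$. $Q^{\pm}(2m-1,q)$ denotes the projective quadric $\{P(a)\in PG(2m-1,q): \Theta(a)=0\}$ of such a form of type $\pm1$. A line is tangent to a quadric if it meets it in exactly one point or is contained in it. $NO^{\pm}(2m,2)$: the graph whose vertices are the points of $PG(2m-1,2)$ not on a non-singular quadric $Q^{\pm}(2m-1,2)$, two vertices being adjacent iff they lie on a line tangent to the quadric. $NO^{\pm}(2m+1,q)$ ($q$ even): take a non-singular parabolic quadric $Q(2m,q)$ in $PG(2m,q)$ (zero set of a quadratic form on $\mathbb{F}_q^{2m+1}$ of maximal Witt index $m$); its polar form has a $1$-dimensional radical whose projective point $N$ is the nucleus. Vertices are the hyperplanes $H$ with $N\notin H$ such that $H\cap Q(2m,q)$ is a non-singular quadric of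 type $\pm1$ in $H$; two such hyperplanes $H_1,H_2$ are adjacent iff $H_1\cap H_2\cap Q(2m,q)$ is a degenerate (singular) quadric in $H_1\cap H_2$. A two-graph is a pair $(X,T)$ with $T$ a set of 3-subsets of $X$ such that every 4-subset of $X$ contains an even number of members of $T$. The two-graph associated with a graph $G$ on vertex set $X$ is $(X,T)$ where $T$ consists of the 3-subsets inducing an odd number of edges. Two graphs on the same vertex set are switching equivalent if one is obtained from the other by Seidel switching with respect to some vertex subset $Y$ (replacing edges between $Y$ and its complement by non-edges and vice versa). $\mathcal{X}^{\pm}_{2m}$: let $\Theta$ be a non-degenerate quadratic form of type $\pm1$ on $\mathbb{F}_2^{2m}$ with polar (symplectic) form $\langle\cdot,\cdot\rangle$; $\mathcal{X}^{\pm}_{2m}=(X,T)$ with $X=\{a\in\mathbb{F}_2^{2m}:\Theta(a)=1\}$ and $T$ the set of 3-subsets $\{a,b,c\}$ of $X$ (distinct elements) with $\langle a,b\rangle+\langle a,c\rangle+\langle b,c\rangle=0$. *)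

(* Defs.v *)
From HB Require Import structures.
From mathcomp Require Import all_boot all_order all_algebra all_fingroup all_field.
Set Implicit Arguments. Unset Strict Implicit. Unset Printing Implicit Defensive.
Import GRing.Theory.
Local Open Scope ring_scope.

Section Quad.
Variable F : finFieldType.
Variable n : nat.
Implicit Types Q : 'rV[F]_n -> F.

Definition is_quadform Q : Prop :=
  exists A : 'M[F]_n, forall x, Q x = (x *m A *m x^T) 0 0.

Definition polar Q (u v : 'rV[F]_n) : F := Q (u + v) + Q u + Q v.

Definition nondegenerate Q : bool :=
  [forall u, [forall v, polar Q u v == 0] ==> (u == 0)].

Definition has_ts Q (k : nat) : bool :=
  [exists U : 'M[F]_(k, n),
     (\rank U == k) && [forall x : 'rV[F]_k, Q (x *m U) == 0]].

Definition witt_index Q : nat := \max_(k < n.+1 | has_ts Q k) k.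

Definition radical Q : {set 'rV[F]_n} := [set u | [forall v, polar Q u v == 0]].

(* projective points of PG(n-1,F): 1-dimensional subspaces (as vector sets) *)
Definition ppoint (v : 'rV[F]_n) : {set 'rV[F]_n} := [set a *: v | a : F].
Definition pgpoints : {set {set 'rV[F]_n}} :=
  [set ppoint v | v in [set v : 'rV[F]_n | v != 0]].
Definition psing Q (P : {set 'rV[F]_n}) : bool := [forall v in P, Q v == 0].
Definition pline (P R : {set 'rV[F]_n}) : {set {set 'rV[F]_n}} :=
  [set S in pgpoints | S \subset [set p + r | p in P, r in R]].
Definition tangent Q (L : {set {set 'rV[F]_n}}) : bool :=
  (#|[set S in L | psing Q S]| == 1%N) || [forall S in L, psing Q S].

Definition NO_even_vertices Q : {set {set 'rV[F]_n}} :=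
  [set P in pgpoints | ~~ psing Q P].
Definition NO_even_adj Q : rel {set 'rV[F]_n} :=
  fun P R => (P != R) && tangent Q (pline P R).

Definition nonsingular_parabolic Q (m : nat) : Prop :=
  [/\ exists2 r, r != 0 & radical Q = ppoint r,
      forall r, r \in radical Q -> r != 0 -> Q r != 0
    & witt_index Q = m].

Definition hyperplane_of (w : 'cV[F]_n) : {set 'rV[F]_n} := [set x | x *m w == 0].
Definition hyperplanes : {set {set 'rV[F]_n}} :=
  [set hyperplane_of w | w in [set w : 'cV[F]_n | w != 0]].

(* the quadric meets the subspace S in a singular quadric:
   there is a singular point of Q in S whose polar contains S *)
Definition sing_in Q (S : {set 'rV[F]_n}) : bool :=
  [exists x in S, [&& x != 0, Q x == 0 & [forall y in S, polar Q x y == 0]]].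

End Quad.

Section Types.
Variable F : finFieldType.

(* non-degenerate form on F^(2m) of type +1 (b = true) or -1 (b = false) *)
Definition of_type (m : nat) (b : bool) (Q : 'rV[F]_(2 * m) -> F) : bool :=
  nondegenerate Q && (witt_index Q == (if b then m else m.-1)%N).

(* H /\ Q is a non-singular quadric of type b in the 2k-dim. subspace H:
   the form Q restricted to H (in coordinates w.r.t. a basis B of H)
   is non-degenerate of type b *)
Definition restr_type n (Q : 'rV[F]_n -> F) (H : {set 'rV[F]_n}) (k : nat) (b : bool)
  : bool :=
  [exists B : 'M[F]_(2 * k, n),
     [&& \rank B == (2 * k)%N, H == [set x *m B | x : 'rV[F]_(2 * k)]
       & of_type b (fun x => Q (x *m B))]].

(* NO^{+-}(2m+1,q): hyperplanes not through the nucleus (= radical) meeting Q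
   in a non-singular quadric of type b; adjacency: intersection is singular *)
Definition NO_odd_vertices (m : nat) (Q : 'rV[F]_((2 * m).+1) -> F) (b : bool)
  : {set {set 'rV[F]_((2 * m).+1)}} :=
  [set H in hyperplanes _ _ | ~~ (radical Q \subset H) && restr_type Q H m b].
Definition NO_odd_adj n (Q : 'rV[F]_n -> F) : rel {set 'rV[F]_n} :=
  fun H1 H2 => (H1 != H2) && sing_in Q (H1 :&: H2).

Definition X_set n (Q : 'rV[F]_n -> F) : {set 'rV[F]_n} := [set a | Q a == 1].
Definition X_triples n (Q : 'rV[F]_n -> F) : {set {set 'rV[F]_n}} :=
  [set t | [exists a, exists b, exists c,
     [&& a \in X_set Q, b \in X_set Q, c \in X_set Q,
         a != b, a != c, b != c, t == [set a; b; c]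
       & polar Q a b + polar Q a c + polar Q b c == 0]]].
End Types.

Section TwoGraph.
Variable T : finType.

Definition edges_in (adj : rel T) (t : {set T}) : nat :=
  #|[set e : {set T} | [&& e \subset t, #|e| == 2%N &
        [forall x in e, forall y in e, (x != y) ==> adj x y]]]|.

Definition twograph_of_graph (X : {set T}) (adj : rel T) : {set {set T}} :=
  [set t : {set T} | [&& t \subset X, #|t| == 3%N & odd (edges_in adj t)]].

Definition switching_equivalent (X : {set T}) (adj adj' : rel T) : Prop :=
  exists2 Y : {set T}, Y \subset X &
    forall x y, x \in X -> y \in X -> x != y ->
      adj' x y = adj x y (+) ((x \in Y) (+) (y \in Y)).
End TwoGraph.

Definition twograph_iso (T T' : finType) (X : {set T}) (TT : {set {set T}})
  (X' : {set T'}) (TT' : {set {set T'}}) : Prop :=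
  exists f : T -> T',
    [/\ {in X &, injective f}, f @: X = X' &
        forall t : {set T}, t \subset X -> #|t| = 3%N ->
          (t \in TT) = (f @: t \in TT')].

(* graphs on different vertex sets are switching equivalent after
   identifying the vertex sets by some bijection f *)
Definition switching_equivalent_iso (T T' : finType) (X : {set T}) (adj : rel T)
  (X' : {set T'}) (adj' : rel T') : Prop :=
  exists f : T -> T',
    [/\ {in X &, injective f}, f @: X = X' &
        switching_equivalent X adj (fun x y => adj' (f x) (f y))].

(* Main.v *)
(** Over a finite field of even order with trace [tr], the type of a nondegenerate
    form [Q] in even dimension is the sign of the exponential sum
    [S(Q) = sum_x (-1)^tr(Q x)].  Adding the square of a linear functional [f(., a)],
    with [f] the polar form, multiplies this sum by [(-1)^tr(Q a)].

    Over F_2, two forms with equivalent polar forms differ, after a change of basis,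
    by such a functional [f(., a)]; if their types agree then [Q a = 0], and the
    transvection [x |-> x + f(x, a) a] carries one form to the other.  So forms of the
    same type are isometric.

    In the parabolic case normalise the functional [w] so that [w(r)^2 = Q r] on the
    nucleus [r].  The hyperplanes off the nucleus are then the
    [H_a = {x | w(x) = f(x, a)}] for [a] in [H = ker w], and projecting [H_a] to [H]
    along [r] turns [Q] on [H_a] into [Q + f(., a)^2] on [H].  If [H] has type [b],
    those of type [~~ b] are the [H_a] with [tr (Q a) = 1], and [tr o Q] is a form of
    type [b] on [H] over F_2.  Finally [H_a] and [H_b] are adjacent iff
    [Q a + Q b + f(a, b) + f(a, b)^2 = 0].  Over F_4 the last two terms give
    [tr (f(a, b))] and [Q a + Q b] is a coboundary, because [Q a] and [Q b] are among
    the two elements of trace 1: this is a Seidel switching of [tr (f(a, b)) = 0]. *)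
From mathcomp Require Import all_boot all_order all_algebra all_fingroup all_field.
From mathcomp Require Import mxabelem zify ring.
Require Import Defs.
Set Implicit Arguments. Unset Strict Implicit. Unset Printing Implicit Defensive.
Import GRing.Theory Num.Theory Order.TTheory.
Local Open Scope ring_scope.

(** * Quadratic forms and their polar forms in characteristic 2 *)

Section QuadraticForms.
Variables (F : finFieldType) (charF : 2%N \in [pchar F]).

(** [ring] does not know that the characteristic is 2, so an identity valid only modulo 2 is handed
    to it with an explicit double [z + z] added. *)
Lemma char2_eq (z x y : F) : x = y + (z + z) -> x = y.
Proof. by rewrite (addrr_pchar2 charF) addr0. Qed.

Lemma addvv m n (u : 'M[F]_(m, n)) : u + u = 0.
Proof. by apply/matrixP => i j; rewrite !mxE addrr_pchar2. Qed.

Lemma addvK m n (v : 'M[F]_(m, n)) : cancel (+%R^~ v) (+%R^~ v).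
Proof. by move=> u; rewrite /= -addrA addvv addr0. Qed.

Lemma addv_eq0 m n (u v : 'M[F]_(m, n)) : (u + v == 0) = (u == v).
Proof.
by apply/eqP/eqP => [e|->]; [rewrite -(addvK v u) /= e add0r | rewrite addvv].
Qed.

Lemma addf_eq0 (x y : F) : (x + y == 0) = (x == y).
Proof. by rewrite addr_eq0 oppr_pchar2. Qed.

Lemma sqr_inj : injective (fun z : F => z ^+ 2).
Proof. by move=> y z /= /eqP; rewrite eqf_sqr oppr_pchar2 // orbb => /eqP. Qed.

Lemma exists_sqrt (x : F) : exists y, y ^+ 2 = x.
Proof. by exists (invF sqr_inj x); apply: (f_invF sqr_inj). Qed.

Section Polar.
Variables (n : nat) (Q : 'rV[F]_n -> F).

Lemma polarC u v : polar Q u v = polar Q v u.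
Proof. by rewrite /polar [u + v]addrC addrAC. Qed.

Lemma quadD u v : Q (u + v) = Q u + Q v + polar Q u v.
Proof. by rewrite /polar; apply: (@char2_eq (- (Q u + Q v))); ring. Qed.

Hypothesis quadQ : is_quadform Q.

Lemma quadformZ c u : Q (c *: u) = c ^+ 2 * Q u.
Proof.
have [A QE] := quadQ.
by rewrite !QE linearZ /= -!scalemxAl -scalemxAr scalerA mxE expr2.
Qed.

Lemma quadform0 : Q 0 = 0.
Proof. by rewrite -(scale0r (0 : 'rV_n)) quadformZ expr0n mul0r. Qed.

(** The Gram matrix is [A + A^T]; the bilinearity lemmas below are read off from it. *)
Lemma polar_mx : exists M : 'M[F]_n, forall u v, polar Q u v = (u *m M *m v^T) 0 0.
Proof.
have [A QE] := quadQ; exists (A + A^T) => u v; rewrite /polar !QE.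
have trE : (u *m A^T *m v^T) 0 0 = (v *m A *m u^T) 0 0 :> F.
  by rewrite -[v *m A *m u^T]trmxK [RHS]mxE !trmx_mul trmxK mulmxA.
have mxD (X Y : 'M[F]_1) : (X + Y) 0 0 = X 0 0 + Y 0 0 by rewrite mxE.
rewrite linearD /= !(mulmxDl, mulmxDr) !mxD trE.
set a := (u *m A *m u^T) 0 0; set b := (v *m A *m v^T) 0 0.
by apply: (@char2_eq (a + b)); ring.
Qed.

Lemma polarDl u v w : polar Q (u + v) w = polar Q u w + polar Q v w.
Proof. by have [M pE] := polar_mx; rewrite !pE !mulmxDl mxE. Qed.

Lemma polarDr u v w : polar Q w (u + v) = polar Q w u + polar Q w v.
Proof. by rewrite !(polarC w) polarDl. Qed.

Lemma polarZl c u v : polar Q (c *: u) v = c * polar Q u v.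
Proof. by have [M pE] := polar_mx; rewrite !pE -!scalemxAl mxE. Qed.

Lemma polarZr c u v : polar Q u (c *: v) = c * polar Q u v.
Proof. by rewrite !(polarC u) polarZl. Qed.

Lemma polarvv u : polar Q u u = 0.
Proof. by rewrite /polar addvv quadform0 add0r addrr_pchar2. Qed.

Lemma polar0l u : polar Q 0 u = 0.
Proof. by rewrite -(scale0r (0 : 'rV_n)) polarZl mul0r. Qed.
End Polar.

Lemma quadform_comp n k (Q : 'rV[F]_n -> F) (B : 'M_(k, n)) :
  is_quadform Q -> is_quadform (fun x => Q (x *m B)).
Proof.
by case=> A QE; exists (B *m A *m B^T) => x; rewrite QE trmx_mul !mulmxA.
Qed.

Lemma polar_comp n k (Q : 'rV[F]_n -> F) (B : 'M_(k, n)) u v :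
  polar (fun x => Q (x *m B)) u v = polar Q (u *m B) (v *m B).
Proof. by rewrite /polar mulmxDl. Qed.

(** Properties of the absolute trace to F_2, with xor as addition. Stating them abstractly lets F_2
    and F_4 share the arguments on exponential sums. *)
Definition is_trace (tr : F -> bool) :=
  [/\ {morph tr : x y / x + y >-> x (+) y},
      forall x, tr (x ^+ 2) = tr x & exists x, tr x].

(** * Exponential sums of quadratic forms and their sign *)

Section Trace.
Variables (tr : F -> bool) (trP : is_trace tr).
Definition sgn (x : F) : int := (-1) ^+ tr x.

Lemma trD : {morph tr : x y / x + y >-> x (+) y}. Proof. by case: trP. Qed.
Lemma trX2 x : tr (x ^+ 2) = tr x. Proof. by case: trP. Qed.
Lemma tr0 : tr 0 = false.
Proof. by rewrite -(addrr_pchar2 charF 0) trD addbb. Qed.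
Lemma sgnD x y : sgn (x + y) = sgn x * sgn y.
Proof. by rewrite /sgn trD signr_addb. Qed.
Lemma sgn0 : sgn 0 = 1. Proof. by rewrite /sgn tr0. Qed.

Definition expsum (T : finType) (Q : T -> F) (H : {set T}) : int :=
  \sum_(x in H) sgn (Q x).

(** The involution [h] reverses the sign of every term, so the integer sum equals its own
    opposite. *)
Lemma sum_flip (T : finType) (h : T -> T) (H : {set T}) (Q : T -> F) c :
  tr c -> involutive h -> (forall x, (h x \in H) = (x \in H)) ->
  (forall x, Q (h x) = Q x + c) -> expsum Q H = 0.
Proof.
move=> trc hh hH hQ; suff : expsum Q H = - expsum Q H by lia.
rewrite {1}/expsum (reindex_inj (inv_inj hh)) /expsum -sumrN.
apply: eq_big => [x|x _]; first exact: hH.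
by rewrite hQ sgnD {2}/sgn trc mulrN1.
Qed.

Lemma sum_sgn : \sum_c sgn c = 0.
Proof.
have [_ _ [c trc]] := trP.
transitivity (expsum (@id F) [set: F]); first by apply: eq_bigl => x; rewrite inE.
apply: (@sum_flip _ (+%R^~ c) _ _ c) => // x; last by rewrite !inE.
by rewrite -addrA addrr_pchar2 // addr0.
Qed.

(** With [y = s ^+ 2], the term at [c] is the sign of [(c * s) ^+ 2], hence of [c * s], which runs
    over all nonzero scalars; the full sum is 0 and its term at 0 is 1. *)
Lemma sum_sgn_scaled y : y != 0 -> \sum_(c in predC1 0) sgn (c ^+ 2 * y) = -1.
Proof.
have [s <-] := exists_sqrt y; rewrite sqrf_eq0 => s0.
have := sum_sgn; rewrite (bigD1 0) //= sgn0 => /eqP; rewrite addrC addr_eq0 => /eqP <-.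
rewrite [RHS](reindex_inj (mulIf s0)).
apply: eq_big => c; first by rewrite inE /= mulf_eq0 (negPf s0) orbF.
by rewrite -exprMn /sgn trX2.
Qed.

Section Witt.
Variables (n : nat) (Q : 'rV[F]_n -> F).
Hypothesis quadQ : is_quadform Q.

Definition perp j (U : 'M[F]_(j, n)) : {set 'rV[F]_n} :=
  [set x | [forall y : 'rV_j, polar Q x (y *m U) == 0]].

(* Averaging over the translates by U leaves only the terms orthogonal to U. *)
Lemma expsum_perp j (U : 'M[F]_(j, n)) : (forall y, Q (y *m U) = 0) ->
  expsum Q setT = expsum Q (perp U).
Proof.
move=> QU; set q : int := #|{: 'rV[F]_j}|%:R.
have q0 : q != 0 by rewrite pnatr_eq0 -lt0n; apply/card_gt0P; exists 0.
apply: (mulIf q0).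
transitivity (\sum_(y : 'rV[F]_j) \sum_(x : 'rV[F]_n) sgn (Q (x + y *m U))).
  rewrite mulr_natr -sumr_const; apply: eq_bigr => y _.
  rewrite /expsum (reindex_inj (addIr (y *m U))).
  by apply: eq_bigl => x; rewrite inE.
rewrite exchange_big /= /expsum mulr_suml [RHS]big_mkcond /=.
apply: eq_bigr => x _; rewrite inE.
under eq_bigr => y _ do rewrite quadD QU addr0 sgnD.
rewrite -mulr_sumr; case: ifPn => [/forallP xU|].
  congr (_ * _); under eq_bigr => y _ do rewrite (eqP (xU y)) sgn0.
  by rewrite sumr_const.
rewrite negb_forall => /existsP[y0 xy0]; have [_ _ [t trt]] := trP.
set c := polar Q x (y0 *m U) in xy0.
pose g y := polar Q x (y *m U).
have -> : \sum_y sgn (polar Q x (y *m U)) = expsum g setT.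
  by apply: eq_bigl => y; rewrite inE.
(* Translating [y] by [(t / c) *: y0] adds [t], of trace 1, to the linear form [g], so its character
   sum vanishes. *)
rewrite (@sum_flip _ (+%R^~ ((t / c) *: y0)) _ _ t trt) ?mulr0 ?mul0r // => [|y|y].
- exact: addvK.
- by rewrite !inE.
- by rewrite /g mulmxDl -scalemxAl polarDr // polarZr // -/c divfK.
Qed.

Hypothesis ndQ : nondegenerate Q.

Lemma nondegenerateP u : (forall v, polar Q u v = 0) -> u = 0.
Proof.
move=> u0; move/forallP/(_ u)/implyP: ndQ => ndu; apply/eqP/ndu.
by apply/forallP => v; rewrite u0.
Qed.

(** [perp U] is the kernel of [M *m U^T], where the Gram matrix [M] is invertible by
    nondegeneracy. *)
Lemma card_perp j (U : 'M[F]_(j, n)) : #|perp U| = (#|F| ^ (n - \rank U))%N.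
Proof.
have [M pE] := polar_mx quadQ.
have freeM : row_free M.
  rewrite -kermx_eq0; apply/rowV0P => u /sub_kermxP uM.
  by apply: nondegenerateP => v; rewrite pE uM mul0mx mxE.
have -> : perp U = rowg (kermx (M *m U^T)).
  apply/setP => x; rewrite !inE; apply/forallP/sub_kermxP => [xU|xU y].
    apply/rowP => i; have /eqP := xU (delta_mx 0 i).
    by rewrite pE trmx_mul trmx_delta !mulmxA -colE mxE => ->; rewrite mxE.
  by rewrite pE trmx_mul mulmxA -(mulmxA x) xU mul0mx mxE.
rewrite card_rowg mxrank_ker -mxrank_tr trmx_mul trmxK mxrankMfree //.
by rewrite row_free_unit unitmx_tr -row_free_unit.
Qed.

Lemma sub_perp j (U : 'M[F]_(j, n)) : (forall y, Q (y *m U) = 0) ->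
  rowg U \subset perp U.
Proof.
move=> QU; apply/subsetP => x; rewrite !inE => /submxP[z ->].
apply/forallP => y; rewrite /polar -mulmxDl !QU !addr0 //.
Qed.

Lemma has_tsP j : reflect
  (exists2 U : 'M[F]_(j, n), \rank U = j & forall y, Q (y *m U) = 0) (has_ts Q j).
Proof.
apply: (iffP existsP) => [[U /andP[/eqP rU /forallP QU]]|[U rU QU]]; exists U => //.
  by move=> y; apply/eqP.
by rewrite rU eqxx; apply/forallP => y; apply/eqP.
Qed.

Lemma has_ts_le j : has_ts Q j -> (2 * j <= n)%N.
Proof.
case/has_tsP => U rU QU; have := subset_leq_card (sub_perp QU).
rewrite card_rowg card_perp rU leq_exp2l ?finNzRing_gt1 //.
have := rank_leq_col U; rewrite rU; lia.
Qed.

Lemma witt_has_ts : has_ts Q (witt_index Q).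
Proof.
have ts0 : has_ts Q (ord0 : 'I_n.+1).
  apply/has_tsP; exists 0; first by rewrite mxrank0.
  by move=> y; rewrite mulmx0 quadform0.
by rewrite /witt_index (bigop.bigmax_eq_arg ord0 ts0); case: arg_maxnP.
Qed.

Lemma leq_witt j : has_ts Q j -> (j <= witt_index Q)%N.
Proof.
move=> tsj; have jn : (j < n.+1)%N by have := has_ts_le tsj; lia.
exact: (@bigop.leq_bigmax_cond _ _ (fun i : 'I_n.+1 => nat_of_ord i) (Ordinal jn)).
Qed.

(** A totally singular [U] of half the dimension is its own perp, by counting, so all remaining
    terms are 1. *)
Lemma expsum_gt0 j : n = (2 * j)%N -> has_ts Q j -> 0 < expsum Q setT.
Proof.
move=> nE /has_tsP[U rU QU]; rewrite (expsum_perp QU).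
have <- : rowg U = perp U.
  apply/eqP; rewrite eqEcard sub_perp // card_perp card_rowg rU nE.
  by rewrite leq_exp2l ?finNzRing_gt1 //; lia.
rewrite /expsum (eq_bigr (fun=> 1)) => [|x]; last first.
  by rewrite inE => /submxP[y ->]; rewrite QU sgn0.
by rewrite sumr_const ltr0n card_rowg expn_gt0 (ltnW (finNzRing_gt1 F)).
Qed.

(** Write q for [#|F|]. A singular vector in [perp U] outside [U] would enlarge [U], so none lies in
    the difference [D]. There each punctured line contributes -1, in all -q^j (q + 1), against q^j
    from [U]; the total is -q^(j+1). *)
Lemma expsum_lt0 j : n = (2 * j.+1)%N -> has_ts Q j -> ~~ has_ts Q j.+1 ->
  expsum Q setT < 0.
Proof.
move=> nE /has_tsP[U rU QU] no_ts; rewrite (expsum_perp QU).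
set D := perp U :\: rowg U.
have QD x : x \in D -> Q x != 0.
  rewrite !inE => /andP[xU /forallP xp]; apply: contra no_ts => /eqP Qx.
  rewrite -addn1; apply/has_tsP; exists (col_mx U x) => [|y].
    have : (\rank U < \rank (U + x)%MS)%N.
      by apply: rank_ltmx; rewrite ltmxE addsmxSl addsmx_sub submx_refl.
    by rewrite addsmxE rU => lt; apply/eqP; rewrite eqn_leq rank_leq_row [leqLHS]addn1.
  rewrite -[y]hsubmxK mul_row_col [rsubmx y]mx11_scalar mul_scalar_mx.
  rewrite quadD QU quadformZ // Qx polarC polarZl // (eqP (xp _)).
  by rewrite !mulr0 !addr0.
(* On each line of D the values c ^+ 2 * Q x run over all nonzero scalars. *)
have DZ c x : c != 0 -> (c *: x \in D) = (x \in D).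
  move=> c0; rewrite !inE (eqmx_scale _ c0); congr (_ && _).
  by apply: eq_forallb => y; rewrite polarZl // mulf_eq0 (negPf c0).
have sumD : expsum Q D *+ (#|F|.-1) = - #|D|%:R.
  rewrite -(cardC1 0) -sumr_const.
  transitivity (\sum_(c in predC1 0) \sum_(x in D) sgn (c ^+ 2 * Q x)).
    apply: eq_bigr => c; rewrite inE /= => c0; rewrite /expsum.
    rewrite (reindex_inj (can_inj (scalerK c0))).
    by apply: eq_big => x; [rewrite DZ | rewrite quadformZ].
  rewrite exchange_big /= (eq_bigr (fun=> -1)) => [|x /QD]; last exact: sum_sgn_scaled.
  by rewrite sumr_const mulNrn.
have -> : expsum Q (perp U) = #|rowg U|%:R + expsum Q D.
  rewrite /expsum (big_setID (rowg U)) /= (setIidPr (sub_perp QU)); congr (_ + _).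
  rewrite (eq_bigr (fun=> 1)) => [|x]; first by rewrite sumr_const.
  by rewrite inE => /submxP[y ->]; rewrite QU sgn0.
have cardD : (#|D| = #|F| ^ (j.+2) - #|F| ^ j)%N.
  rewrite cardsD (setIidPr (sub_perp QU)) card_perp card_rowg rU nE.
  by congr (_ ^ _ - _)%N; lia.
have q1 : (1 < #|F|)%N by apply: finNzRing_gt1.
have q2 : (0 < #|F|.-1)%N by rewrite -subn1 subn_gt0.
(* The inequality is multiplied by q - 1, the number of nonzero scalars, to avoid a division. *)
rewrite card_rowg rU -(pmulrn_llt0 _ q2).
rewrite mulrnDl sumD cardD -mulrnA subr_lt0 ltr_nat.
have : (0 < #|F| ^ j)%N by rewrite expn_gt0 ltnW.
rewrite !expnS; move: (#|F| ^ j)%N q1 => p; move: #|F| => q; nia.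
Qed.
End Witt.

(** [0 < k] excludes the zero space, where [k.-1] is truncated and both types coincide. *)
Lemma of_type_expsum k b (Q : 'rV[F]_(2 * k) -> F) : (0 < k)%N ->
  is_quadform Q -> of_type b Q ->
  expsum Q setT != 0 /\ (0 < expsum Q setT) = b.
Proof.
move=> k0 quadQ /andP[ndQ /eqP wQ]; have tsQ := witt_has_ts quadQ.
case: b wQ => wQ; rewrite wQ in tsQ.
  by have S0 := expsum_gt0 quadQ ndQ erefl tsQ; rewrite S0 gt_eqF.
suff S0 : expsum Q setT < 0 by rewrite lt_eqF // ltNge ltW.
case: k k0 Q quadQ ndQ wQ tsQ => // k _ Q quadQ ndQ wQ tsQ.
apply: (expsum_lt0 quadQ ndQ erefl tsQ); apply/negP => /(leq_witt quadQ ndQ).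
by rewrite wQ ltnn.
Qed.

(** The Witt index is at most [k] by [has_ts_le] and at least [k.-1] by assumption. *)
Lemma of_type_total k (Q : 'rV[F]_(2 * k) -> F) : (0 < k)%N ->
  is_quadform Q -> nondegenerate Q -> has_ts Q k.-1 -> exists b, of_type b Q.
Proof.
move=> k0 quadQ ndQ tsQ; have le1 := leq_witt quadQ ndQ tsQ.
have := has_ts_le quadQ ndQ (witt_has_ts quadQ); rewrite leq_pmul2l // => le2.
exists (witt_index Q == k); rewrite /of_type ndQ /=.
have [/eqP //|/eqP wk] := eqVneq (witt_index Q) k.
by apply/eqP; move: le1 le2 wk; lia.
Qed.

End Trace.
End QuadraticForms.

(** * Symplectic bases and equivalence of alternating forms *)

Section SymplecticBasis.
Variables (F : finFieldType).

(** Orthogonal sum with a hyperbolic plane. The size [1 + 1 + k] converts to [k'.+1 * 2] when [k] is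
    [k' * 2], so [hyp_mx] needs no cast. *)
Definition add_hyp k (J : 'M[F]_k) : 'M_(1 + 1 + k) :=
  block_mx (block_mx (0 : 'M_1) 1%:M 1%:M (0 : 'M_1)) 0 0 J.

Lemma add_hyp_sqr k (J : 'M_k) : J *m J = 1%:M -> add_hyp J *m add_hyp J = 1%:M.
Proof.
move=> JJ; rewrite /add_hyp !mulmx_block JJ.
by rewrite !(mulmx0, mul0mx, mulmx1, addr0, add0r) -!scalar_mx_block.
Qed.

Fixpoint hyp_mx k : 'M[F]_(k * 2) :=
  if k is k'.+1 then add_hyp (hyp_mx k') else 0.

Lemma hyp_mx_sqr k : hyp_mx k *m hyp_mx k = 1%:M.
Proof.
elim: k => [|k IHk]; first by apply/matrixP => -[].
exact: add_hyp_sqr.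
Qed.

(** Induction on [k]: a rank count gives a nonzero [u] orthogonal to [U], invertibility of [A] gives
    a [w] pairing to 1 with [u], and [w] is then made orthogonal to [U]. *)
Lemma symplectic_family n (A : 'M[F]_n) k :
  A \in unitmx -> A^T = A -> (forall u : 'rV_n, u *m A *m u^T = 0) ->
  (k * 2 <= n)%N -> exists U : 'M[F]_(k * 2, n), U *m A *m U^T = hyp_mx k.
Proof.
move=> unitA symA altA; elim: k => [|k IHk] kn.
  by exists 0; apply/matrixP => -[].
have [|U UE] := IHk; first by lia.
have [u uU u0] : exists2 u : 'rV[F]_n, u *m A *m U^T = 0 & u != 0.
  have : kermx (A *m U^T) != 0.
    rewrite kermx_eq0 /row_free; apply/eqP => e.
    by have := rank_leq_col (A *m U^T); rewrite e; lia.
  by case/rowV0Pn => u /sub_kermxP uU u0; exists u; rewrite // -mulmxA.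
have [i ui] : exists i, (u *m A) 0 i != 0.
  apply/existsP; rewrite -negb_forall; apply: contra u0 => /forallP u0.
  have uA : u *m A = 0 by apply/rowP => i; rewrite (eqP (u0 i)) mxE.
  by rewrite -[u](mulmxK unitA) uA mul0mx.
pose w := ((u *m A) 0 i)^-1 *: delta_mx 0 i : 'rV[F]_n.
have uw : u *m A *m w^T = 1%:M.
  rewrite /w linearZ /= trmx_delta -scalemxAr -colE.
  have -> : col i (u *m A) = ((u *m A) 0 i)%:M.
    by apply/matrixP => a b; rewrite !ord1 [LHS]mxE [RHS]mxE.
  by rewrite scale_scalar_mx mulVf.
(* Correct w to be orthogonal to U, using that hyp_mx k is its own inverse. *)
pose w' := w - w *m A *m U^T *m hyp_mx k *m U.
have w'U : w' *m A *m U^T = 0.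
  rewrite /w' !mulmxBl -!mulmxA (mulmxA U A) UE hyp_mx_sqr mulmx1.
  by rewrite subrr.
have uw' : u *m A *m w'^T = 1%:M.
  by rewrite /w' linearB /= mulmxBr uw trmx_mul mulmxA uU mul0mx subr0.
have swapA m1 m2 (X : 'M_(m1, n)) (Y : 'M_(m2, n)) : X *m A *m Y^T = (Y *m A *m X^T)^T.
  by rewrite !trmx_mul trmxK symA mulmxA.
suff e : col_mx (col_mx u w') U *m A *m (col_mx (col_mx u w') U)^T
         = add_hyp (hyp_mx k) by exists (col_mx (col_mx u w') U).
rewrite !(mul_col_mx, tr_col_mx, mul_mx_row) UE !altA uw' uU w'U.
rewrite (swapA _ _ w' u) uw' trmx1 (swapA _ _ U u) uU (swapA _ _ U w') w'U !trmx0.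
rewrite /add_hyp (block_mxEh _ _ _ (hyp_mx k)) col_mx0; congr row_mx.
by rewrite -[LHS]block_mxEh block_mxEv row_mx0 block_mxEh.
Qed.

(** Both forms have a basis with Gram matrix [hyp_mx k]; [P] is the change of basis between the
    two. *)
Lemma symplectic_equiv k (A B : 'M[F]_(k * 2)) :
  A \in unitmx -> A^T = A -> (forall u : 'rV_(k * 2), u *m A *m u^T = 0) ->
  B \in unitmx -> B^T = B -> (forall u : 'rV_(k * 2), u *m B *m u^T = 0) ->
  exists2 P : 'M[F]_(k * 2), P \in unitmx & P *m A *m P^T = B.
Proof.
move=> uA sA aA uB sB aB.
have [U UE] := symplectic_family uA sA aA (leqnn _).
have [V VE] := symplectic_family uB sB aB (leqnn _).
have [uJ _] := mulmx1_unit (hyp_mx_sqr k).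
have uU : U \in unitmx by move: uJ; rewrite -UE !unitmx_mul => /andP[/andP[]].
have uV : V \in unitmx by move: uJ; rewrite -VE !unitmx_mul => /andP[/andP[]].
exists (invmx V *m U); first by rewrite unitmx_mul unitmx_inv uV.
rewrite trmx_mul trmx_inv !mulmxA -(mulmxA _ U) -(mulmxA _ (U *m A)) UE -VE.
by rewrite !mulmxA mulVmx // mul1mx mulmxK // unitmx_tr.
Qed.
End SymplecticBasis.

(** * Isometry of quadratic forms over F_2 *)

Section BinaryForms.
Variables (F : finFieldType) (cardF : #|F| = 2%N).

Lemma F2_char : 2%N \in [pchar F].
Proof. by apply: (@card_finPcharP _ 2 1). Qed.
Let charF := F2_char.

Lemma F2P (x : F) : x = 0 \/ x = 1.
Proof.
have /eqP := expf_card x; rewrite cardF -subr_eq0 expr2 -{3}[x]mulr1 -mulrBr mulf_eq0.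
by rewrite subr_eq0 => /orP[]/eqP; [left | right].
Qed.

Definition F2_tr (x : F) := x != 0.

Lemma F2_trP : is_trace F2_tr.
Proof.
rewrite /F2_tr; split=> [x y|x|]; last by exists 1; rewrite oner_eq0.
  case: (F2P x) => ->; case: (F2P y) => ->; rewrite ?addr0 ?add0r ?eqxx ?oner_eq0 //.
  by rewrite addrr_pchar2 // eqxx.
by rewrite sqrf_eq0.
Qed.

(** The only scalars are 0 and 1, so additive maps are linear. *)
Lemma F2_additive n (f : 'rV[F]_n -> F) : {morph f : x y / x + y} ->
  forall u, f u = (u *m \col_i f (delta_mx 0 i)) 0 0.
Proof.
move=> fD u; have f0 : f 0 = 0 by apply: (addrI (f 0)); rewrite -fD !addr0.
rewrite {1}[u]row_sum_delta (big_morph f fD f0) mxE; apply: eq_bigr => i _.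
by rewrite mxE; case: (F2P (u 0 i)) => ->; rewrite ?scale0r ?mul0r // scale1r mul1r.
Qed.

(** Biadditivity is assumed in place of [is_quadform] because the trace form obtained from F_4 below
    does not come with a matrix. *)
Lemma F2_polar_mx n (Q : 'rV[F]_n -> F) :
  (forall u, {morph polar Q u : x y / x + y}) -> nondegenerate Q ->
  exists A : 'M[F]_n, [/\ forall u v, polar Q u v = (u *m A *m v^T) 0 0,
    A \in unitmx, A^T = A & forall u : 'rV_n, u *m A *m u^T = 0].
Proof.
move=> QD ndQ; pose A : 'M[F]_n := \matrix_(i, j) polar Q (delta_mx 0 j) (delta_mx 0 i).
have AE u v : polar Q u v = (v *m A *m u^T) 0 0.
  rewrite (F2_additive (QD u)) -mulmxA; congr ((_ *m _) 0 0).
  apply/colP => j; rewrite mxE polarC (F2_additive (QD _)) !mxE.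
  by apply: eq_bigr => i _; rewrite !mxE mulrC polarC.
have pE u v : polar Q u v = (u *m A *m v^T) 0 0 by rewrite polarC AE.
exists A; split=> // [||u].
- rewrite -row_free_unit -kermx_eq0; apply/rowV0P => u /sub_kermxP uA.
  by apply: (nondegenerateP ndQ) => v; rewrite pE uA mul0mx mxE.
- by apply/matrixP => i j; rewrite !mxE polarC.
(* [polar Q u u] collapses to [Q 0], and so does [polar Q 0 0], which is 0 by bilinearity. *)
- apply/matrixP => i j; rewrite !ord1 -pE mxE /polar (addvv charF).
  have : polar Q 0 0 = 0 by rewrite pE !mul0mx mxE.
  by rewrite -addrA addrr_pchar2 // /polar addr0 -addrA addrr_pchar2.
Qed.

(** Equality of types is expressed by the signs of the exponential sums, which can be computed
    directly for the trace form from F_4. *)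
Lemma F2_isometry n k (Q R : 'rV[F]_n -> F) : n = (k * 2)%N ->
  (forall u, {morph polar Q u : x y / x + y}) -> nondegenerate Q ->
  (forall u, {morph polar R u : x y / x + y}) -> nondegenerate R ->
  expsum F2_tr Q setT != 0 -> expsum F2_tr R setT != 0 ->
  (0 < expsum F2_tr Q setT) = (0 < expsum F2_tr R setT) ->
  exists th : 'rV[F]_n -> 'rV[F]_n,
    [/\ bijective th, {morph th : x y / x + y} & forall x, R x = Q (th x)].
Proof.
move=> nE; subst n => QD ndQ RD ndR SQ0 SR0 sgnE.
have [A [AE uA sA aA]] := F2_polar_mx QD ndQ.
have [B [BE uB sB aB]] := F2_polar_mx RD ndR.
have [P uP PE] := symplectic_equiv uA sA aA uB sB aB.
pose Q1 x := Q (x *m P).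
have Q1E u v : polar Q1 u v = polar R u v.
  by rewrite [LHS]polar_comp AE BE -PE trmx_mul !mulmxA.
(* [R] and [Q1] have the same polar form, so [R + Q1] is additive, hence represented by some [a]
   through the nondegenerate polar form. *)
have [a RE] : exists a, forall x, R x = Q1 x + polar R x a.
  have LD : {morph (fun x => R x + Q1 x) : x y / x + y}.
    move=> x y /=; rewrite (quadD charF R) (quadD charF Q1) Q1E.
    by apply: (@char2_eq _ charF (polar R x y)); ring.
  pose l := \col_i ((fun x => R x + Q1 x) (delta_mx 0 i)) : 'cV[F]_(k * 2).
  exists (invmx B *m l)^T => x; rewrite BE trmxK mulmxA mulmxK //.
  rewrite -(F2_additive LD).
  by apply: (@char2_eq _ charF (- Q1 x)); ring.
(* Completing the square: [R (x + a) = Q1 x + Q1 a]. *)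
have SRE : expsum F2_tr R setT = sgn F2_tr (Q1 a) * expsum F2_tr Q setT.
  rewrite /expsum (reindex_inj (addIr a)) [in RHS](reindex_inj (can_inj (mulmxK uP))).
  rewrite mulr_sumr; apply: eq_big => x; rewrite ?inE // => _.
  rewrite RE -/(Q1 _) -(sgnD F2_trP); congr sgn.
  rewrite (quadD charF Q1) Q1E (polarC R (x + a)) RD (polarC R a x).
  have -> : polar R a a = 0 by rewrite BE aB mxE.
  by apply: (@char2_eq _ charF (polar R x a)); ring.
have Qa : Q1 a = 0.
  case: (F2P (Q1 a)) => // Qa1; move: SRE SQ0 SR0 sgnE.
  rewrite /sgn /F2_tr Qa1 oner_eq0 mulN1r => ->.
  by rewrite oppr_eq0 oppr_gt0; case: ltgtP.
(* Since [Q1 a = 0], this transvection adds to [Q1 x] the square of [polar R x a], which over F_2 is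
   [polar R x a] itself. *)
pose T x := x + polar R x a *: a.
have Ra : polar R a a = 0 by rewrite BE aB mxE.
have pD x y : polar R (x + y) a = polar R x a + polar R y a.
  by rewrite !(polarC R _ a) RD.
have Tx x : polar R (T x) a = polar R x a.
  rewrite pD; case: (F2P (polar R x a)) => ->; last by rewrite scale1r Ra addr0.
  by rewrite scale0r BE !mul0mx mxE addr0.
have TT : involutive T by move=> x; rewrite {1}/T Tx [X in X + _]/T (addvK charF).
exists (fun x => T x *m P); split.
- by exists (fun y => T (y *m invmx P)) => x; rewrite ?mulmxK ?TT ?mulmxKV.
- by move=> x y; rewrite /T pD scalerDl addrACA mulmxDl.
have Q10 : Q1 0 = 0.
  have : polar Q1 0 0 = 0 by rewrite Q1E BE !mul0mx mxE.
  by rewrite /polar addr0 -addrA addrr_pchar2 // addr0.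
have R0 x : polar R x 0 = 0 by rewrite BE trmx0 mulmx0 mxE.
move=> x; rewrite -/(Q1 (T x)) /T (quadD charF Q1) Q1E RE.
have [e|e] := F2P (polar R x a); rewrite e.
  by rewrite scale0r Q10 R0 !addr0.
by rewrite !scale1r Qa addr0 e.
Qed.

End BinaryForms.

(** * Two-graphs and switching through a common model *)

Lemma odd_edges_in (T : finType) (adj : rel T) (x y z : T) :
  x != y -> x != z -> y != z ->
  adj y x = adj x y -> adj z x = adj x z -> adj z y = adj y z ->
  odd (edges_in adj [set x; y; z]) = adj x y (+) adj x z (+) adj y z.
Proof.
move=> xy xz yz sxy sxz syz.
pose P (e : {set T}) := [forall u in e, forall v in e, (u != v) ==> adj u v].
have P2 u v : u != v -> adj v u = adj u v -> P [set u; v] = adj u v.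
  move=> uv suv; apply/forall_inP/idP => [Puv|uvE w].
    have /forall_inP/(_ v) := Puv u (set21 _ _).
    by rewrite set22 uv => /(_ isT).
  rewrite !inE => /orP[]/eqP->; apply/forall_inP => w'; rewrite !inE => /orP[]/eqP->;
  by rewrite ?eqxx ?suv ?uvE ?implybT.
pose E : {set {set T}} := [set [set x; y]; [set x; z]; [set y; z]].
have -> : edges_in adj [set x; y; z] = (\sum_(e in E) P e)%N.
  rewrite /edges_in -sum1_card [in RHS]big_mkcond [in LHS]big_mkcond /=.
  apply: eq_bigr => e _; rewrite inE andbA -/(P e).
  have -> : (e \subset [set x; y; z]) && (#|e| == 2%N) = (e \in E).
    rewrite !inE; apply/andP/idP => [[/subsetP sub /cards2P[u [v [uv eE]]]]|].
      have := sub u; have := sub v; rewrite eE !inE !eqxx orbT /= => /(_ isT) hv /(_ isT) hu.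
      move: uv; case/orP: hu => [/orP[]|] /eqP->; case/orP: hv => [/orP[]|] /eqP->;
      by rewrite ?eqxx // => _; rewrite ?eqxx ?orbT // setUC ?eqxx ?orbT.
    case/orP => [/orP[]|] /eqP ->; rewrite cards2 ?xy ?xz ?yz; split=> //;
    by apply/subsetP => w; rewrite !inE => /orP[]/eqP->; rewrite ?eqxx ?orbT.
  by case: (e \in E); case: (P e).
have ne1 : [set x; y] != [set x; z].
  by apply: contraNneq yz => /setP/(_ y); rewrite !inE eqxx orbT [y == x]eq_sym (negPf xy) => /esym.
have ne2 : [set x; y] != [set y; z].
  by apply: contraNneq xy => /setP/(_ x); rewrite !inE eqxx (negPf xz) orbF => /esym.
have ne3 : [set x; z] != [set y; z].
  by apply: contraNneq xy => /setP/(_ x); rewrite !inE eqxx (negPf xz) !orbF => /esym.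
rewrite /E setUC big_setU1 ?inE 1?negb_or 1?eq_sym ?ne2 1?eq_sym ?ne3 //=.
rewrite big_setU1 ?inE // big_set1 !P2 // !oddD !oddb.
by rewrite addbC.
Qed.

Section Representations.
Variables (F : finFieldType) (cardF : #|F| = 2%N).
Let charF := F2_char cardF.
Variables (n : nat) (R : 'rV[F]_n -> F) (quadR : is_quadform R).

Lemma mem_X_triples a b c : a \in X_set R -> b \in X_set R -> c \in X_set R ->
  a != b -> a != c -> b != c ->
  ([set a; b; c] \in X_triples R) = (polar R a b + polar R a c + polar R b c == 0).
Proof.
(* The sum of the polar values depends only on the set {u, v, w}. *)
have sumE u v w : u != v -> u != w -> v != w ->
    polar R u v + polar R u w + polar R v w
    = R (\sum_(x in [set u; v; w]) x) + \sum_(x in [set u; v; w]) R x.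
  move=> uv uw vw.
  have wuv : w \notin [set u; v] by rewrite !inE negb_or ![w == _]eq_sym uw.
  have sum3 (V : nmodType) (f : 'rV[F]_n -> V) :
      \sum_(x in [set u; v; w]) f x = f w + (f u + f v).
    by rewrite setUC big_setU1 //= big_setU1 ?inE //= big_set1.
  rewrite !sum3.
  rewrite !(quadD charF R) (polarDr charF quadR) !(polarC R w).
  by apply: (@char2_eq _ charF (- (R u + R v + R w))); ring.
move=> Xa Xb Xc ab ac bc; rewrite inE; apply/existsP/idP => [[a' /existsP[b' /existsP[c']]]|e].
  case/and5P => _ _ _ ab' /and4P[ac' bc' /eqP tE].
  by rewrite !sumE // tE.
by exists a; apply/existsP; exists b; apply/existsP; exists c; rewrite Xa Xb Xc ab ac bc eqxx.
Qed.

(** The common model is the orthogonality graph on [X_set R], whose two-graph is [X_triples R]; [s]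
    is the indicator of the switching set. *)
Definition switching_rep (T : finType) (X : {set T}) (adj : rel T)
    (g : 'rV[F]_n -> T) (s : 'rV[F]_n -> bool) :=
  [/\ {in X_set R &, injective g}, g @: X_set R = X &
      forall u v, u \in X_set R -> v \in X_set R -> u != v ->
        adj (g u) (g v) = (polar R u v == 0) (+) (s u (+) s v)].

Lemma rep_inverse (T : finType) (X : {set T}) (g : 'rV[F]_n -> T) :
  {in X_set R &, injective g} -> g @: X_set R = X ->
  exists f : T -> 'rV[F]_n,
    [/\ f @: X = X_set R, {in X, forall x, f x \in X_set R} & {in X, cancel f g}].
Proof.
(* The default [0] is reached only outside [X]. *)
move=> injg gX; pose f x := odflt 0 [pick u in X_set R | g u == x].
have fg : {in X_set R, cancel g f}.
  move=> u Xu; rewrite /f; case: pickP => [v /andP[Xv /eqP/injg->] //|/(_ u)].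
  by rewrite Xu eqxx.
have fX : {in X, forall x, f x \in X_set R}.
  by move=> x; rewrite -gX => /imsetP[u Xu ->]; rewrite fg.
exists f; split=> // [|x]; last by rewrite -gX => /imsetP[u Xu ->]; rewrite fg.
apply/setP => u; apply/imsetP/idP => [[x Xx ->]|Xu]; first exact: fX.
by exists (g u); rewrite ?fg // -gX imset_f.
Qed.

(** Each vertex of a triple lies on two of its pairs, so the values of [s] cancel modulo 2. An odd
    number of the three pairs is orthogonal exactly when the polar values sum to 0. *)
Lemma rep_twograph (T : finType) (X : {set T}) adj g s :
  switching_rep X adj g s ->
  twograph_iso X (twograph_of_graph X adj) (X_set R) (X_triples R).
Proof.
case=> injg gX adjE; have [f [fXE fX gf]] := rep_inverse injg gX.
have injf : {in X &, injective f} := can_in_inj gf.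
exists f; split=> // t tX t3; rewrite inE tX t3 eqxx /=.
have [x [y [z [xy xz yz tE]]]] : exists x y z, [/\ x != y, x != z, y != z & t = [set x; y; z]].
  have /card_gt0P[x xt] : (0 < #|t|)%N by rewrite t3.
  have /eqP := t3; rewrite (cardsD1 x) xt => /cards2P[y [z [yz e]]].
  have : (y \in t :\ x) && (z \in t :\ x) by rewrite e set21 set22.
  rewrite !inE => /andP[/andP[yx _] /andP[zx _]].
  exists x, y, z; split; rewrite // 1?eq_sym //.
  by rewrite -setUA -e setD1K.
have [Xx Xy Xz] : [/\ x \in X, y \in X & z \in X].
  by split; apply: (subsetP tX); rewrite tE !inE eqxx ?orbT.
have adjX u v : u \in X -> v \in X -> u != v ->
    adj u v = (polar R (f u) (f v) == 0) (+) (s (f u) (+) s (f v)).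
  move=> Xu Xv uv; rewrite -{1}[u]gf // -{1}[v]gf // adjE ?fX //.
  by apply: contraNneq uv => /injf->.
have adjC u v : u \in X -> v \in X -> u != v -> adj v u = adj u v.
  move=> Xu Xv uv; have vu : v != u by rewrite eq_sym.
  by rewrite !adjX // polarC [s _ (+) _]addbC.
have fne u v : u \in X -> v \in X -> u != v -> f u != f v.
  by move=> Xu Xv; apply: contraNneq => /injf->.
rewrite tE odd_edges_in //; try exact: adjC.
have -> : f @: [set x; y; z] = [set f x; f y; f z] by rewrite !imsetU !imset_set1.
rewrite mem_X_triples ?fX ?fne // !adjX //.
case: (F2P cardF (polar R (f x) (f y))) => ->; case: (F2P cardF (polar R (f x) (f z))) => ->;
case: (F2P cardF (polar R (f y) (f z))) => ->;
rewrite ?(addr0, add0r, addrr_pchar2 charF, eqxx, oner_eq0);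
by case: (s (f x)); case: (s (f y)); case: (s (f z)).
Qed.

(** Both graphs are switchings of the same model, so they differ by switching where [s] and [s']
    disagree. *)
Lemma rep_switching (T T' : finType) (X : {set T}) adj g s (X' : {set T'}) adj' g' s' :
  switching_rep X adj g s -> switching_rep X' adj' g' s' ->
  switching_equivalent_iso X adj X' adj'.
Proof.
case=> injg gX adjE [injg' gX' adjE']; have [f [fXE fX gf]] := rep_inverse injg gX.
have injf : {in X &, injective f} := can_in_inj gf.
exists (g' \o f); split=> [x y Xx Xy /= /injg'/injf -> //||]; rewrite ?fX //.
  by rewrite imset_comp fXE.
exists [set x in X | s (f x) (+) s' (f x)].
  by apply/subsetP => x; rewrite inE => /andP[].
move=> x y Xx Xy xy /=.
have fxy : f x != f y by apply: contraNneq xy => /injf->.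
have -> : adj x y = adj (g (f x)) (g (f y)) by rewrite !gf.
rewrite adjE' ?fX // adjE ?fX // !inE Xx Xy /=.
case: (_ == 0); case: (s (f x)); case: (s (f y)); case: (s' (f x)); case: (s' (f y)) => //.
Qed.
End Representations.

(** * The graph on the points off a quadric over F_2 *)

Section EvenGraph.
Variables (F : finFieldType) (cardF : #|F| = 2%N).
Let charF := F2_char cardF.
Variables (n : nat) (Q : 'rV[F]_n -> F) (quadQ : is_quadform Q).

Lemma F2_ppoint (v : 'rV[F]_n) : ppoint v = [set 0; v].
Proof.
apply/setP => u; rewrite !inE; apply/imsetP/orP => [[c _ ->]|].
  by case: (F2P cardF c) => ->; rewrite ?scale0r ?scale1r eqxx; [left | right].
by case=> /eqP->; [exists 0; rewrite ?scale0r | exists 1; rewrite ?scale1r].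
Qed.

Lemma ppoint_inj (u v : 'rV[F]_n) : u != 0 -> ppoint u = ppoint v -> u = v.
Proof.
move=> u0; rewrite !F2_ppoint => /setP/(_ u).
by rewrite !inE eqxx (negPf u0) => /esym/eqP.
Qed.

Lemma psing_ppoint (v : 'rV[F]_n) : psing Q (ppoint v) = (Q v == 0).
Proof.
rewrite F2_ppoint; apply/forall_inP/idP => [-> //|Qv u]; first by rewrite set22.
by rewrite !inE => /orP[]/eqP-> //; rewrite (quadform0 quadQ).
Qed.

Lemma X_set_neq0 (v : 'rV[F]_n) : v \in X_set Q -> v != 0.
Proof. by rewrite inE; apply: contraTneq => ->; rewrite (quadform0 quadQ) eq_sym oner_eq0. Qed.

Lemma F2_pline (u v : 'rV[F]_n) : u != 0 -> v != 0 -> u != v ->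
  pline (ppoint u) (ppoint v) = [set ppoint u; ppoint v; ppoint (u + v)].
Proof.
move=> u0 v0 uv; apply/setP => S; rewrite !inE.
have pg w : w != 0 -> ppoint w \in pgpoints F n by move=> w0; rewrite imset_f ?inE.
have inL w : ppoint w \subset [set p + r | p in ppoint u, r in ppoint v] =
             (w \in [set p + r | p in ppoint u, r in ppoint v]).
  rewrite F2_ppoint; apply/subsetP/idP => [-> //|wL x]; first by rewrite set22.
  rewrite !inE => /orP[]/eqP-> //; apply/imset2P; exists 0 0; rewrite ?addr0 //;
  by rewrite F2_ppoint set21.
apply/andP/idP => [[/imsetP[w]]|].
  rewrite inE => w0 ->; rewrite inL => /imset2P[p r].
  rewrite !F2_ppoint !inE => /orP[]/eqP-> /orP[]/eqP-> wE; move: w0; rewrite wE.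
  - by rewrite addr0 eqxx.
  - by rewrite add0r eqxx orbT.
  - by rewrite addr0 eqxx.
  - by rewrite eqxx !orbT.
have [uP vP] : u \in ppoint u /\ v \in ppoint v by rewrite !F2_ppoint !set22.
have [uP0 vP0] : 0 \in ppoint u /\ 0 \in ppoint v by rewrite !F2_ppoint !set21.
case/orP => [/orP[]|] /eqP ->; rewrite inL pg ?(addv_eq0 charF) //; split=> //; apply/imset2P.
- by exists u 0; rewrite ?addr0.
- by exists 0 v; rewrite ?add0r.
- by exists u v.
Qed.

(** The line has three points, two of them off the quadric, so it is tangent exactly when the third
    is singular; and [Q (u + v) = polar Q u v] because [Q u = Q v = 1]. *)
Lemma NO_even_adjE u v : u \in X_set Q -> v \in X_set Q -> u != v ->
  NO_even_adj Q (ppoint u) (ppoint v) = (polar Q u v == 0).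
Proof.
move=> Xu Xv uv; have [u0 v0] := (X_set_neq0 Xu, X_set_neq0 Xv).
rewrite /NO_even_adj; have -> : ppoint u != ppoint v.
  by apply: contraNneq uv => /ppoint_inj->.
move: Xu Xv; rewrite !inE => /eqP Qu /eqP Qv.
have Quv : Q (u + v) = polar Q u v.
  by rewrite (quadD charF Q) Qu Qv addrr_pchar2 // add0r.
rewrite /= /tangent F2_pline // -Quv -psing_ppoint.
have nall : [forall S in [set ppoint u; ppoint v; ppoint (u + v)], psing Q S] = false.
  apply/forall_inP => /(_ (ppoint u)); rewrite !inE eqxx psing_ppoint Qu oner_eq0.
  by move/(_ isT).
rewrite nall orbF; have [puv|puv] := boolP (psing Q (ppoint (u + v))).
  rewrite (_ : [set S in _ | _] = [set ppoint (u + v)]) ?cards1 //.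
  apply/setP => S; rewrite !inE; apply/andP/eqP => [[]|->]; last by rewrite eqxx orbT.
  by case/orP => [/orP[]|] /eqP-> //; rewrite psing_ppoint ?Qu ?Qv oner_eq0.
rewrite (_ : [set S in _ | _] = set0) ?cards0 //; apply/setP => S; rewrite !inE.
apply/negP => /andP[]; case/orP => [/orP[]|] /eqP->; rewrite ?(negPf puv) //;
by rewrite psing_ppoint ?Qu ?Qv oner_eq0.
Qed.

Lemma NO_even_rep (R : 'rV[F]_n -> F) (th : 'rV[F]_n -> 'rV[F]_n) :
  bijective th -> {morph th : x y / x + y} -> (forall x, R x = Q (th x)) ->
  switching_rep R (NO_even_vertices Q) (NO_even_adj Q) (@ppoint F n \o th) (fun=> false).
Proof.
move=> bij_th thD RE; have inj_th := bij_inj bij_th.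
have XE u : (u \in X_set R) = (th u \in X_set Q) by rewrite !inE RE.
split=> [u v|| u v].
- by rewrite !XE => Xu _ /= /(ppoint_inj (X_set_neq0 Xu))/inj_th.
- apply/setP => P; rewrite !inE; apply/imsetP/andP => [[u Xu ->]|[/imsetP[v]]].
    rewrite /= psing_ppoint; move: (Xu); rewrite XE => /X_set_neq0 th0.
    by rewrite imset_f ?inE //; move: Xu; rewrite inE RE => /eqP->; rewrite oner_eq0.
  rewrite inE => v0 ->; rewrite psing_ppoint => Qv; have [th' thK thK'] := bij_th.
  exists (th' v); rewrite /= ?thK' // XE thK' inE.
  by case: (F2P cardF (Q v)) Qv => ->; rewrite ?eqxx.
- rewrite !XE => Xu Xv uv; rewrite /= NO_even_adjE ?(inj_eq inj_th) // addbF.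
  by rewrite /polar !RE thD.
Qed.
End EvenGraph.

(** Puts a prescribed [k] in place of [\rank A] in the type of the basis. *)
Lemma exists_row_base (F : fieldType) p n (A : 'M[F]_(p, n)) k : \rank A = k ->
  exists2 B : 'M[F]_(k, n), \rank B = k & (B :=: A)%MS.
Proof. by case: k /; exists (row_base A); [rewrite eq_row_base | exact: eq_row_base]. Qed.

(** * Hyperplanes off the nucleus of a parabolic quadric *)

Section ParabolicQuadric.
Variables (F : finFieldType) (charF : 2%N \in [pchar F]).
Variables (tr : F -> bool) (trP : is_trace tr).
Variables (m : nat) (m_gt0 : (0 < m)%N).
Variables (Q : 'rV[F]_((2 * m).+1) -> F) (quadQ : is_quadform Q).
Variable (r : 'rV[F]_((2 * m).+1)).
Hypotheses (rad_r : forall v, polar Q r v = 0) (Qr_neq0 : Q r != 0)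
  (radP : forall u, (forall v, polar Q u v = 0) -> exists c, u = c *: r)
  (tsQ : has_ts Q m).
Notation V := 'rV[F]_((2 * m).+1).
Notation W := 'cV[F]_((2 * m).+1).
Implicit Types (w : W) (x y a b : V).

Lemma rad_rr v : polar Q v r = 0. Proof. by rewrite polarC. Qed.

Definition ev w x : F := (x *m w) 0 0.

Lemma mem_hyper w x : (x \in hyperplane_of w) = (ev w x == 0).
Proof.
rewrite inE; apply/eqP/eqP => [xw|e]; first by rewrite /ev xw mxE.
by apply/matrixP => i j; rewrite !ord1 [RHS]mxE.
Qed.

Lemma evD w x y : ev w (x + y) = ev w x + ev w y.
Proof. by rewrite /ev mulmxDl mxE. Qed.

Lemma evZ w c x : ev w (c *: x) = c * ev w x.
Proof. by rewrite /ev -scalemxAl mxE. Qed.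

Lemma hyper_basis w : ev w r != 0 -> exists2 B : 'M[F]_(2 * m, (2 * m).+1),
  \rank B = (2 * m)%N & hyperplane_of w = [set x *m B | x : 'rV_(2 * m)].
Proof.
move=> rw; have rank_w : \rank w = 1%N.
  apply/eqP; rewrite eqn_leq rank_leq_col lt0n mxrank_eq0.
  by apply: contraNneq rw => ->; rewrite /ev mulmx0 mxE.
have [|B rB BE] := @exists_row_base _ _ _ (kermx w) (2 * m).
  by rewrite mxrank_ker rank_w subn1.
exists B => //; apply/setP => x; rewrite inE -sub_kermx -BE.
by apply/submxP/imsetP => -[y]; [move=> ->; exists y | move=> _ ->; exists y].
Qed.

Section Basis.
Variables (w : W) (rw : ev w r != 0) (B : 'M[F]_(2 * m, (2 * m).+1)).
Hypotheses (rB : \rank B = (2 * m)%N)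
  (BE : hyperplane_of w = [set x *m B | x : 'rV_(2 * m)]).

Lemma basis_inj : injective (fun x : 'rV[F]_(2 * m) => x *m B).
Proof.
have fB : row_free B by rewrite /row_free rB.
by move=> x y; apply: (row_free_inj fB).
Qed.

Lemma proj_hyper x : exists c, x + c *: r \in hyperplane_of w.
Proof.
exists (ev w x / ev w r); rewrite mem_hyper evD evZ divfK //.
by rewrite addrr_pchar2.
Qed.

(** The hyperplane and the radical vector [r] span the space, so [x] is orthogonal to everything and
    is a multiple of [r]; only 0 is such a multiple in the hyperplane. *)
Lemma hyper_nondeg x : x \in hyperplane_of w ->
  (forall y, y \in hyperplane_of w -> polar Q x y = 0) -> x = 0.
Proof.
move=> xH xp; have [v|c xE] := radP (u := x).
  have [c /xp] := proj_hyper v.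
  by rewrite (polarDr charF quadQ) (polarZr charF quadQ) rad_rr mulr0 addr0.
move: xH; rewrite mem_hyper xE evZ mulf_eq0 (negPf rw) orbF => /eqP->.
by rewrite scale0r.
Qed.

Lemma basis_nondeg : nondegenerate (fun x : 'rV_(2 * m) => Q (x *m B)).
Proof.
apply/forallP => x; apply/implyP => /forallP xp; apply/eqP/basis_inj.
rewrite mul0mx; apply: hyper_nondeg => [|y]; rewrite BE; first by apply/imsetP; exists x.
by case/imsetP => z _ ->; rewrite -polar_comp; apply/eqP.
Qed.

(** A totally singular space of dimension [m] meets a hyperplane in dimension at least [m.-1]; [K]
    selects that many independent vectors and [C] gives their coordinates in [B]. *)
Lemma basis_has_ts : has_ts (fun x : 'rV_(2 * m) => Q (x *m B)) m.-1.
Proof.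
have /has_tsP[U rU QU] := tsQ.
have rK : (m.-1 <= \rank (kermx (U *m w)))%N.
  by rewrite mxrank_ker -subn1 leq_sub2l // rank_leq_col.
have freeU : row_free U by rewrite /row_free rU.
pose K : 'M_(m.-1, m) := pid_mx m.-1 *m row_base (kermx (U *m w)).
have rankK : \rank (K *m U) = m.-1.
  by rewrite mxrankMfree // /K mxrankMfree ?row_base_free // rank_pid_mx.
have KU : K *m U *m w = 0.
  rewrite -mulmxA; apply/sub_kermxP.
  by rewrite (submx_trans (submxMl _ _)) // eq_row_base.
have /submxP[C CE] : (K *m U <= B)%MS.
  apply/row_subP => i; have : row i (K *m U) \in hyperplane_of w.
    by rewrite inE -row_mul KU row0.
  by rewrite BE => /imsetP[y _ ->]; apply: submxMl.
apply/has_tsP; exists C => [|y]; last by rewrite -mulmxA -CE mulmxA QU.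
apply/eqP; rewrite eqn_leq rank_leq_row -[leqLHS]rankK CE.
exact: mxrankM_maxl.
Qed.

Lemma expsum_basis : expsum tr (fun x : 'rV_(2 * m) => Q (x *m B)) setT = expsum tr Q (hyperplane_of w).
Proof.
rewrite /expsum BE big_imset /= => [|x y _ _]; last exact: basis_inj.
by apply: eq_bigl => x; rewrite !inE.
Qed.
End Basis.

Lemma restr_typeP w (b : bool) : ev w r != 0 -> restr_type Q (hyperplane_of w) m b ->
  expsum tr Q (hyperplane_of w) != 0 /\ (0 < expsum tr Q (hyperplane_of w)) = b.
Proof.
move=> rw /existsP[B /and3P[/eqP rB /eqP BE tyB]].
rewrite -(expsum_basis rB BE).
exact: (of_type_expsum charF trP m_gt0 (quadform_comp B quadQ) tyB).
Qed.

Lemma restr_type_total w : ev w r != 0 -> exists b : bool, restr_type Q (hyperplane_of w) m b.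
Proof.
move=> rw; have [B rB BE] := hyper_basis rw.
have [b tyb] := of_type_total charF m_gt0 (quadform_comp B quadQ)
  (basis_nondeg rw rB BE) (basis_has_ts BE).
by exists b; apply/existsP; exists B; rewrite rB BE !eqxx.
Qed.

(** [restr_type] quantifies over bases, but the sum over the hyperplane is independent of the basis
    and so decides the type. *)
Lemma restr_typeE w (b : bool) : ev w r != 0 ->
  restr_type Q (hyperplane_of w) m b = ((0 < expsum tr Q (hyperplane_of w)) == b).
Proof.
move=> rw; have [b' tyb'] := restr_type_total rw.
have [_ ->] := restr_typeP rw tyb'; apply/idP/eqP => [tyb|<- //].
by have [_ <-] := restr_typeP rw tyb; have [_ <-] := restr_typeP rw tyb'.
Qed.

Lemma expsum_neq0 w : ev w r != 0 -> expsum tr Q (hyperplane_of w) != 0.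
Proof. by move=> rw; have [b /(restr_typeP rw)[]] := restr_type_total rw. Qed.

Variable M : 'M[F]_((2 * m).+1).
Hypothesis ME : forall u v, polar Q u v = (u *m M *m v^T) 0 0.

(* The hyperplane H_a is the kernel of shift w a. *)
Definition shift w a : W := w + M *m a^T.

Lemma ev_shift w a x : ev (shift w a) x = ev w x + polar Q x a.
Proof. by rewrite /ev /shift mulmxDr mxE mulmxA ME. Qed.

Lemma ev_shift_r w a : ev (shift w a) r = ev w r.
Proof. by rewrite ev_shift rad_r addr0. Qed.

Section Shift.
Variables (w : W) (rw2 : ev w r ^+ 2 = Q r).

Lemma normalized_neq0 : ev w r != 0.
Proof. by apply: contraNneq Qr_neq0 => e; rewrite -rw2 e expr0n. Qed.
Let rw := normalized_neq0.

(* The bijection from ker w to H_a along the nucleus. *)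
Definition lift a x : V := x + (polar Q x a / ev w r) *: r.

Lemma polar_lift a x y : polar Q (lift a x) y = polar Q x y.
Proof. by rewrite (polarDl charF quadQ) (polarZl charF quadQ) rad_r mulr0 addr0. Qed.

Lemma liftK a : involutive (lift a).
Proof. by move=> x; rewrite {1}/lift polar_lift [X in X + _]/lift (addvK charF). Qed.

Lemma mem_lift a x : (lift a x \in hyperplane_of (shift w a)) = (x \in hyperplane_of w).
Proof.
rewrite !mem_hyper ev_shift polar_lift evD evZ divfK //.
by rewrite -addrA addrr_pchar2 // addr0.
Qed.

(** The normalisation [ev w r ^+ 2 = Q r] makes the coefficient of the square equal to 1. *)
Lemma quad_lift a x : Q (lift a x) = Q x + polar Q x a ^+ 2.
Proof.
rewrite (quadD charF Q) (polarZr charF quadQ) rad_rr mulr0 addr0 (quadformZ quadQ).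
by rewrite -rw2 -exprMn divfK.
Qed.

(** After [lift], the trace does not distinguish [polar Q x a ^+ 2] from [polar Q x a], and
    [Q x + polar Q x a = Q (x + a) + Q a]. *)
Lemma expsum_shift a : a \in hyperplane_of w ->
  expsum tr Q (hyperplane_of (shift w a)) = sgn tr (Q a) * expsum tr Q (hyperplane_of w).
Proof.
move=> aH; rewrite /expsum (reindex_inj (inv_inj (liftK a))).
rewrite [in RHS](reindex_inj (addIr a)) mulr_sumr.
apply: eq_big => x; rewrite mem_lift.
  by move: aH; rewrite !mem_hyper evD => /eqP->; rewrite addr0.
move=> _; rewrite quad_lift /sgn trD // trX2 // -!trD // -signr_addb -trD //.
congr ((-1) ^+ tr _); rewrite (quadD charF Q).
by apply: (@char2_eq _ charF (- Q a)); ring.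
Qed.

(** Rescaled to agree with [w] at [r], [w'] differs from [w] by a functional [d] vanishing on the
    radical. Such a [d] is polar to some [a], which can be moved along [r] into [ker w]. *)
Lemma shift_surj w' : ev w' r != 0 -> exists2 a, a \in hyperplane_of w &
  hyperplane_of w' = hyperplane_of (shift w a).
Proof.
move=> rw'; pose c := ev w r / ev w' r.
have c0 : c != 0 by rewrite mulf_neq0 ?invr_eq0.
pose d := c *: w' + w.
have rd : r *m d = 0.
  apply/matrixP => i j; rewrite !ord1 /d mulmxDr -scalemxAr [RHS]mxE mxE mxE.
  by rewrite -/(ev w r) -/(ev w' r) divfK // addrr_pchar2.
(* Every column of the cokernel of [M^T] is, transposed, in the radical, hence a multiple of [r],
   where [d] vanishes. *)
have /submxP[a aE] : (d^T <= M^T)%MS.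
  rewrite submxE; apply/eqP/matrixP => i j; rewrite [RHS]mxE ord1.
  have [v|t tE] := radP (u := (col j (cokermx M^T))^T).
    suff KM : (col j (cokermx M^T))^T *m M = 0 by rewrite ME KM mul0mx mxE.
    apply: trmx_inj; rewrite trmx_mul trmxK colE mulmxA mulmx_coker mul0mx.
    by rewrite trmx0.
  have : d^T *m col j (cokermx M^T) = 0.
    apply: trmx_inj; rewrite trmx_mul trmxK tE -scalemxAl rd scaler0.
    by rewrite trmx0.
  by rewrite colE mulmxA -colE => /matrixP/(_ 0 0); rewrite mxE => ->; rewrite mxE.
have [t aH] := proj_hyper rw a.
exists (a + t *: r) => //; apply/setP => x; rewrite !mem_hyper ev_shift.
rewrite (polarDr charF quadQ) (polarZr charF quadQ) rad_rr mulr0 addr0.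
have -> : polar Q x a = c * ev w' x + ev w x.
  rewrite ME -mulmxA; have -> : M *m a^T = d by rewrite -[M]trmxK -trmx_mul -aE trmxK.
  by rewrite /d mulmxDr -scalemxAr mxE [X in X + _]mxE.
rewrite addrC -addrA addrr_pchar2 // addr0 mulf_eq0 (negPf c0) //.
Qed.

Lemma shift_inj : {in hyperplane_of w &, injective (fun a => hyperplane_of (shift w a))}.
Proof.
move=> a b aH bH /= abE; apply/eqP; rewrite -(addv_eq0 charF); apply/eqP.
have abH : a + b \in hyperplane_of w.
  by move: aH bH; rewrite !mem_hyper evD => /eqP-> /eqP->; rewrite addr0.
apply: (hyper_nondeg rw abH) => y yH.
have := yH; rewrite -(mem_lift a) => ya; have := ya; rewrite abE.
move: ya; rewrite !mem_hyper !ev_shift !polar_lift => /eqP ya /eqP yb.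
rewrite polarC (polarDr charF quadQ); move: ya yb; set e := ev w _ => ya yb.
have -> : polar Q y a + polar Q y b = (e + polar Q y a) + (e + polar Q y b).
  by apply/esym/(@char2_eq _ charF e); ring.
by rewrite ya yb addr0.
Qed.

(** The intersection is cut out of [H_a] by orthogonality to [c = a + b]. Its polar radical is the
    line of [c'], the translate of [c] along [r] into [H_a], so singularity means [Q c' = 0]. *)
Lemma sing_in_shift a b : a \in hyperplane_of w -> b \in hyperplane_of w -> a != b ->
  sing_in Q (hyperplane_of (shift w a) :&: hyperplane_of (shift w b))
  = (Q a + Q b + (polar Q a b + polar Q a b ^+ 2) == 0).
Proof.
move=> aH bH ab; pose c := a + b; pose c' := lift a c.
have cH : c \in hyperplane_of w.
  by move: aH bH; rewrite !mem_hyper evD => /eqP-> /eqP->; rewrite addr0.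
have c0 : c != 0 by rewrite (addv_eq0 charF).
have memI x : (x \in hyperplane_of (shift w a) :&: hyperplane_of (shift w b))
    = (x \in hyperplane_of (shift w a)) && (polar Q x c == 0).
  rewrite inE !mem_hyper !ev_shift (polarDr charF quadQ).
  case: eqP => //= e; congr (_ == _).
  rewrite -[RHS]add0r -e.
  by apply/esym/(@char2_eq _ charF (polar Q x a)); ring.
have Qc' : Q c' = Q a + Q b + (polar Q a b + polar Q a b ^+ 2).
  rewrite quad_lift (quadD charF Q) (polarDl charF quadQ) (polarvv charF quadQ) add0r.
  by rewrite (polarC Q b a) -addrA.
rewrite -Qc'; apply/exists_inP/idP => [[x]|/eqP Qc'0].
  rewrite memI => /andP[xa xc] /and3P[x0 /eqP Qx /forall_inP xp].
  (* The radical of the polar form on H_a :&: H_b is the line of c'. *)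
  have xperp y : polar Q y c = 0 -> polar Q x y = 0.
    move=> yc; have [t ytH] := proj_hyper rw y.
    have : lift a (y + t *: r) \in
        hyperplane_of (shift w a) :&: hyperplane_of (shift w b).
      rewrite memI mem_lift ytH polar_lift (polarDl charF quadQ) (polarZl charF quadQ).
      by rewrite yc rad_r mulr0 addr0 eqxx.
    move/xp/eqP; rewrite polarC polar_lift polarC (polarDr charF quadQ).
    by rewrite (polarZr charF quadQ) rad_rr mulr0 addr0.
  have [z cz] : exists z, polar Q c z != 0.
    apply/existsP; rewrite -negb_forall; apply: contra c0 => /forallP c0.
    by apply/eqP/(hyper_nondeg rw cH) => y _; apply/eqP.
  (* Any [v] becomes orthogonal to [c] after adding a multiple of [z]; this choice of [t] makes
     [x + t *: c] orthogonal to all [v]. *)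
  pose t := polar Q x z / polar Q c z.
  have [v|s xE] := radP (u := x + t *: c).
    rewrite (polarDl charF quadQ) (polarZl charF quadQ).
    have := xperp (v + (polar Q c v / polar Q c z) *: z).
    rewrite (polarDl charF quadQ) (polarZl charF quadQ) (polarC Q z c) divfK //.
    rewrite (polarC Q v c) addrr_pchar2 // => /(_ erefl).
    rewrite (polarDr charF quadQ) (polarZr charF quadQ) => e.
    by rewrite -[RHS]e /t; field.
  have xE' : x = t *: c' + (s + t * (polar Q c a / ev w r)) *: r.
    rewrite /c' /lift scalerDr scalerA scalerDl -xE addrACA.
    by rewrite (addvv charF) addr0 addrC (addvK charF).
  have c'a : c' \in hyperplane_of (shift w a) by rewrite mem_lift.
  (* Both [x] and [c'] lie in [H_a] while [r] does not. *)
  have s0 : s + t * (polar Q c a / ev w r) = 0.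
    move: xa c'a; rewrite !mem_hyper xE' evD !evZ ev_shift_r => xa /eqP c'a.
    by move: xa; rewrite c'a mulr0 add0r mulf_eq0 (negPf rw) orbF => /eqP.
  have t0 : t != 0.
    by apply: contraNneq x0 => t0; rewrite xE' s0 t0 !scale0r addr0.
  move: Qx; rewrite xE' s0 scale0r addr0 (quadformZ quadQ) => /eqP.
  by rewrite mulf_eq0 sqrf_eq0 (negPf t0).
exists c'; first by rewrite memI mem_lift cH polar_lift (polarvv charF quadQ) eqxx.
apply/and3P; split; rewrite ?Qc'0 //.
  apply: contraNneq c0 => c'0; apply/eqP/(hyper_nondeg rw cH) => y _.
  by rewrite -(polar_lift a) -/c' c'0 (polar0l charF quadQ).
apply/forall_inP => y; rewrite memI => /andP[_ yc].
by rewrite polar_lift polarC.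
Qed.

(** If [polar Q c z'] has trace 1, then the traces of [Q] at [c], [z'] and [c + z'] add up to 1, so
    one of them is 1. *)
Lemma exists_tr_quad : exists2 a, a \in hyperplane_of w & tr (Q a).
Proof.
have [B rB BE] := hyper_basis rw.
have [c cH c0] : exists2 c, c \in hyperplane_of w & c != 0.
  have : B != 0 by rewrite -mxrank_eq0 rB -lt0n muln_gt0.
  by case/rowV0Pn => v /submxP[y ->] c0; exists (y *m B); rewrite // BE; apply/imsetP; exists y.
have [z zH cz] : exists2 z, z \in hyperplane_of w & polar Q c z != 0.
  apply/exists_inP; rewrite -negb_forall_in; apply: contra c0 => /forall_inP c0.
  by apply/eqP/(hyper_nondeg rw cH) => y /c0/eqP.
have [_ _ [t trt]] := trP; pose z' := (t / polar Q c z) *: z.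
have z'H : z' \in hyperplane_of w.
  by move: zH; rewrite !mem_hyper evZ => /eqP->; rewrite mulr0.
have : tr (Q (c + z')) = tr (Q c) (+) tr (Q z') (+) true.
  by rewrite (quadD charF Q) (trD trP) (trD trP) (polarZr charF quadQ) divfK ?trt.
have [Qc|_] := boolP (tr (Q c)); first by exists c.
have [Qz|_] := boolP (tr (Q z')); first by exists z'.
move=> e; exists (c + z'); last by rewrite e.
by move: cH z'H; rewrite !mem_hyper evD => /eqP-> /eqP->; rewrite addr0.
Qed.
End Shift.

(** If a normalised hyperplane has the wrong type, a shift by [a] with [tr (Q a)] flips the sign of
    its sum and keeps the value at [r]. *)
Lemma exists_restr_type (b : bool) : exists2 w, ev w r ^+ 2 = Q r &
  restr_type Q (hyperplane_of w) m b.
Proof.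
have [w rw2] : exists w, ev w r ^+ 2 = Q r.
  have [i ri] : exists i, r 0 i != 0.
    apply/existsP; rewrite -negb_forall; apply: contra Qr_neq0 => /forallP r0.
    suff -> : r = 0 by rewrite (quadform0 quadQ).
    by apply/rowP => i; rewrite (eqP (r0 i)) mxE.
  have [s <-] := exists_sqrt charF (Q r); exists ((s / r 0 i) *: delta_mx i 0).
  by rewrite /ev -scalemxAr -colE mxE mxE divfK.
have rw := normalized_neq0 rw2.
have [tyb|] := boolP (restr_type Q (hyperplane_of w) m b); first by exists w.
have [a aH tra] := exists_tr_quad rw2; rewrite restr_typeE // => tyb.
exists (shift w a); first by rewrite ev_shift_r.
rewrite restr_typeE ?ev_shift_r // expsum_shift // /sgn tra mulN1r.
move: tyb (expsum_neq0 rw); rewrite oppr_gt0.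
by case: ltgtP; case: b.
Qed.
End ParabolicQuadric.

(** * The trace of F_4 and restriction of scalars to F_2 *)

Section QuaternaryField.
Variables (F : finFieldType) (cardF : #|F| = 4%N).

Lemma F4_char : 2%N \in [pchar F].
Proof. by apply: (@card_finPcharP _ 2 2). Qed.
Let charF := F4_char.

Definition F4_tr (x : F) := x + x ^+ 2 != 0.

Lemma F4_sumP (x : F) : x + x ^+ 2 = 0 \/ x + x ^+ 2 = 1.
Proof.
have x4 : x ^+ 4 = x by rewrite -cardF expf_card.
have /eqP : (x + x ^+ 2) * ((x + x ^+ 2) - 1) = 0.
  have -> : (x + x ^+ 2) * ((x + x ^+ 2) - 1) = x ^+ 4 - x + (x ^+ 3 + x ^+ 3) by ring.
  by rewrite x4 subrr add0r addrr_pchar2.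
by rewrite mulf_eq0 subr_eq0 => /orP[]/eqP; [left | right].
Qed.

Lemma F4_trP : is_trace F4_tr.
Proof.
rewrite /F4_tr; split=> [x y|x|].
- have -> : x + y + (x + y) ^+ 2 = (x + x ^+ 2) + (y + y ^+ 2).
    by apply: (@char2_eq _ charF (x * y)); ring.
  case: (F4_sumP x) => ->; case: (F4_sumP y) => ->; rewrite ?addr0 ?add0r ?eqxx ?oner_eq0 //.
  by rewrite addrr_pchar2 // eqxx.
- by rewrite -exprM -(@sqrf_eq0 _ (x + x ^+ 2)) sqrrD mulr2n addrr_pchar2 // addr0 -exprM.
(* Trace 0 forces [x] to be 0 or 1, and the field has four elements. *)
apply/existsP; rewrite -[X in is_true X]negbK negb_exists.
apply/negP => /forallP all0; have : (#|F| <= #|[set 0%R; 1%R : F]|)%N.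
  rewrite -cardsT; apply/subset_leq_card/subsetP => x _; rewrite !inE.
  have := all0 x; rewrite negbK -{1}[x]mulr1 expr2 -mulrDr mulf_eq0.
  by rewrite addrC (addf_eq0 charF).
by rewrite cards2 cardF eq_sym oner_eq0.
Qed.

(** The elements of trace 1 are [om] and [om + 1], so [x + y] is 0 or 1, and it is 1 exactly when
    one of [x], [y] is [om]; [e + e ^+ 2] is the trace of [e]. *)
Lemma F4_tr_quotient (x y om e : F) : F4_tr x -> F4_tr y -> F4_tr om ->
  (x + y + (e + e ^+ 2) == 0) = ~~ F4_tr e (+) ((x == om) (+) (y == om)).
Proof.
have eq_om z : F4_tr om -> F4_tr z -> z = om \/ z = om + 1.
  rewrite /F4_tr; case: (F4_sumP om) => [->|omE]; first by rewrite eqxx.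
  case: (F4_sumP z) => [->|zE _ _]; first by rewrite eqxx.
  have /eqP : (z + om) * (z + om + 1) = 0.
    have -> : (z + om) * (z + om + 1) = (z + z ^+ 2) + (om + om ^+ 2) + (z * om + z * om).
      by ring.
    by rewrite zE omE !addrr_pchar2 // addr0.
  rewrite mulf_eq0 (addf_eq0 charF) => /orP[/eqP|]; first by left.
  by rewrite -addrA (addf_eq0 charF) => /eqP; right.
have om1 : (om + 1 == om) = false.
  by rewrite -subr_eq0 addrAC subrr add0r oner_eq0.
have [d0 d1] : om + om = 0 /\ 1 + 1 = 0 :> F by rewrite !addrr_pchar2.
move=> trx try_ trom; rewrite /F4_tr negbK.
case: (eq_om _ trom trx) => ->; case: (eq_om _ trom try_) => ->;
case: (F4_sumP e) => ->;
by rewrite ?addrA ?(addrAC om 1 om) d0 ?(d1, addr0, add0r) ?(eqxx, oner_eq0, om1) //= ?d1 ?eqxx ?oner_eq0.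
Qed.

Section Descent.
Variables (F2 : finFieldType) (cardF2 : #|F2| = 2%N) (om : F) (tr_om : F4_tr om).
Let charF2 := F2_char cardF2.

Definition F2_F4 (x : F2) : F := (x != 0)%:R.

Lemma F2_F4D : {morph F2_F4 : x y / x + y}.
Proof.
rewrite /F2_F4 => x y; case: (F2P cardF2 x) => ->; case: (F2P cardF2 y) => ->;
by rewrite ?(addr0, add0r, eqxx, oner_eq0) ?addrr_pchar2 ?eqxx.
Qed.

Lemma F2_F4_free (x y : F2) : F2_F4 x + om * F2_F4 y = 0 -> x = 0 /\ y = 0.
Proof.
rewrite /F2_F4; case: (F2P cardF2 x) => ->; case: (F2P cardF2 y) => ->;
rewrite ?(eqxx, oner_eq0, mulr0, mulr1, addr0, add0r) //=.
- by move=> om0; move: tr_om; rewrite /F4_tr om0 expr0n addr0 eqxx.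
- by move/eqP; rewrite oner_eq0.
- move/eqP; rewrite (addf_eq0 charF) => /eqP om1; move: tr_om.
  by rewrite /F4_tr -om1 expr1n addrr_pchar2 // eqxx.
Qed.

(** Coordinates in the F_2-basis 1, [om] of F_4, stored as the two rows of a 2 by [n] matrix. *)
Definition combine n (x : 'rV[F2]_(2 * n)) : 'rV[F]_n :=
  \row_i (F2_F4 (vec_mx x 0 i) + om * F2_F4 (vec_mx x 1 i)).

Lemma combineD n : {morph @combine n : x y / x + y}.
Proof.
move=> x y; apply/rowP => i; rewrite !mxE !F2_F4D.
by ring.
Qed.

Lemma combine_bij n : bijective (@combine n).
Proof.
apply: inj_card_bij => [x y e|]; last first.
  by rewrite !card_mx cardF cardF2 !mul1n expnM.
apply/eqP; rewrite -(addv_eq0 charF2); apply/eqP.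
have : combine (x + y) = 0 by rewrite combineD e (addvv charF).
move: (x + y) => z z0; rewrite -[z]vec_mxK; have -> : vec_mx z = 0 :> 'M_(2, n).
  apply/matrixP => i j; have /rowP/(_ j) := z0; rewrite !mxE => /F2_F4_free[e0 e1].
  suff [->|->] : i = 0 \/ i = 1 by [].
  by case: i => -[|[|//]] lti; [left | right]; apply/val_inj.
by rewrite linear0.
Qed.
End Descent.
End QuaternaryField.

(** * Both graphs as switchings of the common model *)

Lemma NO_odd_rep (F2 F4 : finFieldType) (h2 : #|F2| = 2%N) (h4 : #|F4| = 4%N)
    (m : nat) (b : bool) (Q : 'rV[F4]_((2 * m).+1) -> F4) (R : 'rV[F2]_(2 * (2 * m)) -> F2) :
  (0 < m)%N -> is_quadform Q -> nonsingular_parabolic Q m ->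
  is_quadform R -> of_type b R ->
  exists g s, switching_rep R (NO_odd_vertices Q (~~ b)) (NO_odd_adj Q) g s.
Proof.
move=> m0 quadQ [[r r0 radE] Qrad wQ] quadR tyR.
have [[c2 c4] [tr2P tr4P]] := ((F2_char h2, F4_char h4), (F2_trP h2, F4_trP h4)).
have r_rad : r \in radical Q by rewrite radE; apply/imsetP; exists 1; rewrite ?scale1r.
have Qr := Qrad _ r_rad r0.
have rad_r v : polar Q r v = 0 by move: r_rad; rewrite inE => /forallP/(_ v)/eqP.
have radP u : (forall v, polar Q u v = 0) -> exists c, u = c *: r.
  move=> up; have : u \in radical Q by rewrite inE; apply/forallP => v; rewrite up.
  by rewrite radE => /imsetP[c _ ->]; exists c.
have tsQ : has_ts Q m by have := witt_has_ts quadQ; rewrite wQ.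
have [M ME] := polar_mx c4 quadQ.
have [w rw2 tyw] := exists_restr_type c4 tr4P m0 quadQ rad_r Qr radP tsQ ME b.
have rw : ev w r != 0 := normalized_neq0 Qr rw2.
have [B rB BE] := hyper_basis rw.
(* [om] completes the F_2-basis of F_4, witnesses the nondegeneracy of the trace form, and is the
   value of [Q] defining the switching set. *)
have [_ _ [om tr_om]] := tr4P.
pose psi (x : 'rV[F2]_(2 * (2 * m))) := combine om x *m B.
have psi_bij := combine_bij h4 h2 tr_om (2 * m).
have psiD : {morph psi : x y / x + y}.
  by move=> x y; rewrite /psi (combineD h4 h2) mulmxDl.
have psi_inj : injective psi.
  by move=> x y /(basis_inj rB)/(bij_inj psi_bij).
have psiH x : psi x \in hyperplane_of w by rewrite BE; apply/imsetP; exists (combine om x).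
have psi_surj a : a \in hyperplane_of w -> exists x, a = psi x.
  rewrite BE => /imsetP[y _ ->]; have [k _ kK] := psi_bij.
  by exists (k y); rewrite /psi kK.
pose Q' x : F2 := (F4_tr (Q (psi x)))%:R.
have natb (b1 b2 : bool) : (b1 (+) b2)%:R = b1%:R + b2%:R :> F2.
  by case: b1; case: b2; rewrite ?addr0 ?add0r ?addrr_pchar2.
have natb0 (b1 : bool) : (b1%:R == 0 :> F2) = ~~ b1.
  by case: b1; rewrite ?eqxx ?oner_eq0.
have Q'E u v : polar Q' u v = (F4_tr (polar Q (psi u) (psi v)))%:R.
  by rewrite /polar /Q' psiD -!natb -!(trD tr4P).
have Q'D u : {morph polar Q' u : x y / x + y}.
  by move=> x y; rewrite !Q'E psiD (polarDr c4 quadQ) (trD tr4P) natb.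
have ndQ' : nondegenerate Q'.
  apply/forallP => u; apply/implyP => /forallP up; apply/eqP/psi_inj.
  have -> : psi 0 = 0 by apply: (addrI (psi 0)); rewrite -psiD !addr0.
  apply: (hyper_nondeg c4 quadQ rad_r radP rw (psiH u)) => y yH.
  apply/eqP/negPn/negP => uy.
  (* Rescale [y] so that its polar value with [psi u] is [om], of trace 1. *)
  have [v vE] : exists v, (om / polar Q (psi u) y) *: y = psi v.
    by apply: psi_surj; move: yH; rewrite !mem_hyper evZ => /eqP->; rewrite mulr0.
  by have := up v; rewrite Q'E -vE (polarZr c4 quadQ) divfK // natb0 tr_om.
(* The trace form inherits its sum, hence its sign, from the hyperplane of type [b]. *)
have SQ' : expsum (@F2_tr F2) Q' setT = expsum (@F4_tr F4) Q (hyperplane_of w).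
  have -> : hyperplane_of w = psi @: setT.
    apply/setP => a; apply/idP/imsetP => [/psi_surj[x ->]|[x _ ->]]; last exact: psiH.
    by exists x.
  rewrite /expsum big_imset /= => [|x y _ _]; last exact: psi_inj.
  by apply: eq_bigr => x _; rewrite /sgn /F2_tr natb0 negbK.
have [Sw0 Sw] := restr_typeP c4 tr4P m0 quadQ rw tyw.
have m2 : (0 < 2 * m)%N by rewrite muln_gt0.
have [SR0 SR] := of_type_expsum c2 tr2P m2 quadR tyR.
have /andP[ndR _] := tyR.
have [th [th_bij thD RE]] : exists th : 'rV[F2]_(2 * (2 * m)) -> 'rV[F2]_(2 * (2 * m)),
    [/\ bijective th, {morph th : x y / x + y} & forall x, R x = Q' (th x)].
  apply: (F2_isometry h2 (mulnC 2 (2 * m)) Q'D ndQ' _ ndR); rewrite ?SQ' ?Sw //.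
  by move=> u x y; apply: (polarDr c2 quadR).
pose phi u := psi (th u).
have phi_inj : injective phi by move=> u v /psi_inj/(bij_inj th_bij).
have phiH u : phi u \in hyperplane_of w by apply: psiH.
have XE u : (u \in X_set R) = F4_tr (Q (phi u)).
  by rewrite inE RE /Q' -/(phi u); case: (F4_tr _); rewrite ?eqxx // eq_sym oner_eq0.
have pE u v : polar R u v = (F4_tr (polar Q (phi u) (phi v)))%:R.
  by rewrite -Q'E /polar !RE thD.
have inj_shift := shift_inj c4 quadQ rad_r Qr radP ME rw2.
have S_shift := expsum_shift c4 tr4P quadQ rad_r Qr ME rw2.
have tyE := restr_typeE c4 tr4P m0 quadQ rad_r radP tsQ.
have r_shift a : ev (shift M w a) r = ev w r by apply: (ev_shift_r rad_r ME).
exists (fun u => hyperplane_of (shift M w (phi u))), (fun u => Q (phi u) == om); split.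
- by move=> u v _ _ /(inj_shift _ _ (phiH u) (phiH v))/phi_inj.
- apply/setP => H; rewrite inE; apply/imsetP/and3P => [[u Xu ->]|[/imsetP[w' _ ->] radH]].
    split.
    + rewrite imset_f // inE; apply: contraNneq rw => sh0.
      by rewrite -(r_shift (phi u)) sh0 /ev mulmx0 mxE.
    + by apply/subsetPn; exists r; rewrite // mem_hyper r_shift.
    (* [Q (phi u)] has trace 1, so the sum changes sign and the type is [~~ b]. *)
    rewrite tyE ?r_shift // S_shift // /sgn.
    move: Xu; rewrite XE => ->; rewrite mulN1r oppr_gt0.
    by move: Sw Sw0; case: ltgtP => // _ <-.
  have rw' : ev w' r != 0.
    apply: contra radH => /eqP rw'; apply/subsetP => x.
    by rewrite radE => /imsetP[c _ ->]; rewrite mem_hyper evZ rw' mulr0.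
  have [a aH ->] := shift_surj c4 quadQ rad_r Qr radP ME rw2 rw'.
  rewrite tyE ?r_shift // S_shift // => tyH.
  have [x xE] := psi_surj a aH; have [k _ kK] := th_bij.
  exists (k x); last by rewrite /phi kK xE.
  rewrite XE /phi kK -xE; apply: contraTT tyH; rewrite /sgn => /negPf->.
  by rewrite mul1r Sw; case: (b).
move=> u v; rewrite !XE => tru trv uv; rewrite /NO_odd_adj.
rewrite (inj_in_eq inj_shift) ?phiH // (inj_eq phi_inj) uv /=.
rewrite (sing_in_shift c4 quadQ rad_r Qr radP ME rw2) ?phiH ?(inj_eq phi_inj) //.
by rewrite (F4_tr_quotient h4 _ tru trv tr_om) pE natb0.
Qed.

Lemma NO_even_rep_of_type (F : finFieldType) (h2 : #|F| = 2%N) (m : nat) (b : bool)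
    (Q R : 'rV[F]_(2 * m) -> F) : (0 < m)%N ->
  is_quadform Q -> of_type b Q -> is_quadform R -> of_type b R ->
  exists g s, switching_rep R (NO_even_vertices Q) (NO_even_adj Q) g s.
Proof.
move=> m0 quadQ tyQ quadR tyR; have [c2 tr2P] := (F2_char h2, F2_trP h2).
have [SQ0 SQ] := of_type_expsum c2 tr2P m0 quadQ tyQ.
have [SR0 SR] := of_type_expsum c2 tr2P m0 quadR tyR.
have [/andP[ndQ _] /andP[ndR _]] := (tyQ, tyR).
have [th [th_bij thD RE]] : exists th : 'rV[F]_(2 * m) -> 'rV[F]_(2 * m),
    [/\ bijective th, {morph th : x y / x + y} & forall x, R x = Q (th x)].
  apply: (F2_isometry h2 (mulnC 2 m) _ ndQ _ ndR); rewrite ?SQ ?SR //.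
    by move=> u x y; apply: (polarDr c2 quadQ).
  by move=> u x y; apply: (polarDr c2 quadR).
by exists (@ppoint F (2 * m) \o th), (fun=> false); apply: NO_even_rep.
Qed.

Theorem theorem4p7 (m : nat) (hm : (1 <= m)%N) (b : bool)
  (F2 F4 : finFieldType) (h2 : #|F2| = 2%N) (h4 : #|F4| = 4%N) :
  (* (i) two-graph of NO^b(2m,2) ~ X^b_{2m} *)
  (forall (Q R : 'rV[F2]_(2 * m) -> F2),
     is_quadform Q -> of_type b Q -> is_quadform R -> of_type b R ->
     twograph_iso (NO_even_vertices Q)
       (twograph_of_graph (NO_even_vertices Q) (NO_even_adj Q))
       (X_set R) (X_triples R)) /\
  (* (ii) two-graph of NO^{-b}(2m+1,4) ~ X^b_{4m} *)
  (forall (Q : 'rV[F4]_((2 * m).+1) -> F4) (R : 'rV[F2]_(2 * (2 * m)) -> F2),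
     is_quadform Q -> nonsingular_parabolic Q m ->
     is_quadform R -> of_type b R ->
     twograph_iso (NO_odd_vertices Q (~~ b))
       (twograph_of_graph (NO_odd_vertices Q (~~ b)) (NO_odd_adj Q))
       (X_set R) (X_triples R)) /\
  (* (iii) NO^b(4m,2) and NO^{-b}(2m+1,4) are switching equivalent *)
  (forall (Q : 'rV[F2]_(2 * (2 * m)) -> F2) (R : 'rV[F4]_((2 * m).+1) -> F4),
     is_quadform Q -> of_type b Q ->
     is_quadform R -> nonsingular_parabolic R m ->
     switching_equivalent_iso (NO_even_vertices Q) (NO_even_adj Q)
       (NO_odd_vertices R (~~ b)) (NO_odd_adj R)).
Proof.
split=> [Q R quadQ tyQ quadR tyR|].
  have [g [s rep]] := NO_even_rep_of_type h2 hm quadQ tyQ quadR tyR.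
  exact: (rep_twograph h2 quadR rep).
split=> [Q R quadQ parQ quadR tyR|Q R quadQ tyQ quadR parR].
  have [g [s rep]] := NO_odd_rep h2 h4 hm quadQ parQ quadR tyR.
  exact: (rep_twograph h2 quadR rep).
(* For the switching equivalence, the form [Q] of the even graph itself serves as the model for both
   graphs. *)
have m2 : (0 < 2 * m)%N by rewrite muln_gt0.
have [g [s rep]] := NO_even_rep_of_type h2 m2 quadQ tyQ quadQ tyQ.
have [g' [s' rep']] := NO_odd_rep h2 h4 hm quadR parR quadQ tyQ.
exact: (rep_switching rep rep').
Qed.
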